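(* Let $R$ be a commutative ring with unit and let $\mathcal A_0$ be the free $R$-module freely generated by the set $\mathcal S_0$ of homotopically non-trivial homotopy classes of virtual strings. The $R$-linear homomorphism $\nu:\mathcal A_0\to\mathcal A_0\otimes_R\mathcal A_0$ given on the generators of $\mathcal A_0$ by $$\nu(\langle\alpha\rangle)=\sum_{e\in\mathrm{arr}(\alpha)}\left(\langle\alpha^1_e\rangle\otimes\langle\alpha^2_e\rangle-\langle\alpha^2_e\rangle\otimes\langle\alpha^1_e\rangle\right)$$ is a well-defined Lie cobracket.
   Context: Virtual strings. For $m\ge0$, a virtual string (string) $\alpha$ of rank $m$ is an oriented circle $S$ (core circle) with $2m$ distinguished distinct points (the endpoints of $\alpha$) partitioned into $m$ ordered pairs, the arrows; their set is $\mathrm{arr}(\alpha)$. A homeomorphism of strings is an orientation-preserving homeomorphism of core circles carrying the set of arrows onto the set of arrows. A trivial string has no arrows. For distinct $a,b\in S$, $ab$ denotes the arc of $S$ going from $a$ to $b$ in the positive direction. Homotopy. Consider the following moves on a string $\alpha$ with core circle $S$. $(a)_s$: for distinct $a,b\in S$ such that the arc $ab$ contains no endpoints of $\alpha$, add the arrow $(a,b)$. $(b)_s$: choose two arcs on $S$ disjoint from each other and from the endpoints of $\alpha$; let $a,a'$ be the endpoints of the first arc (in arbitrary order) and $b,b'$ those of the second (in arbitrary order); add the arrows $(a,b)$ and $(b',a')$. $(c)_s$: if $\alpha$ has three arrows $(a^+,b),(b^+,c),(c^+,a)$ such that the arcs $aa^+,bb^+,cc^+$ are disjoint from each other and from the other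 endpoints of $\alpha$, replace them with the arrows $(a,b^+),(b,c^+),(c,a^+)$. Two strings are homotopic if they are related by a finite sequence of homeomorphisms, moves $(a)_s,(b)_s,(c)_s$, and inverse moves. A string is homotopically trivial if it is homotopic to a trivial string. $\mathcal S_0$ is the set of homotopy classes of homotopically non-trivial strings. Notation. For a string $\alpha$, $\langle\alpha\rangle\in\mathcal A_0$ is the generator given by its homotopy class if $\alpha$ is homotopically non-trivial, and $\langle\alpha\rangle=0$ if $\alpha$ is homotopically trivial. For $e=(a,b)\in\mathrm{arr}(\alpha)$, $\alpha^1_e$ is the string obtained from $\alpha$ by removing all arrows except those with both endpoints in the interior of the arc $ab$, and $\alpha^2_e$ is obtained by removing all arrows except those with both endpoints in the interior of $ba$ (in particular $e$ is removed in both). Lie cobracket. A Lie cobracket in an $R$-module $A$ is an $R$-homomorphism $\nu:A\to A\otimes A$ such that $\mathrm{Perm}_A\circ\nu=-\nu$ and $(\mathrm{id}_{A^{\otimes3}}+\tau_A+\tau_A^2)\circ(\mathrm{id}_A\otimes\nu)\circ\nu=0$, where $\mathrm{Perm}_A(x\otimes y)=y\otimes x$ and $\tau_A(x\otimes y\otimes z)=z\otimes x\otimes y$. ''Well-defined'' means that the right-hand side of the formula depends only on the homotopy class of $\alpha$ (and vanishes for homotopically trivial $\alpha$). *)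

(* Defs.v *)
From HB Require Import structures.
From mathcomp Require Import all_boot all_order all_algebra finmap.
From mathcomp Require Import ring_quotient.
From mathcomp Require Import all_classical all_reals topology normedtype.
From Stdlib Require Import Relations.Relation_Operators.

Set Implicit Arguments.
Unset Strict Implicit.
Unset Printing Implicit Defensive.

Import Order.TTheory GRing.Theory Num.Theory.
Import numFieldNormedType.Exports.

Local Open Scope classical_set_scope.
Local Open Scope ring_scope.

Section FreeModule.
Variables (R : pzRingType) (S : choiceType).

Definition supp (f : S -> R) : set S := [set s | f s != 0].

Definition finsupp_pred : {pred S -> R^o} :=
  [pred f | `[< finite_set (supp f) >]].

Lemma finsupp_submod_closed : submod_closed finsupp_pred.
Proof.
split=> [|k f g].
  apply/asboolP; rewrite (_ : supp _ = set0) //.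
  by apply/seteqP; split=> s //=; rewrite /supp /= eqxx.
move=> /asboolP ff /asboolP fg; apply/asboolP.
apply: (@sub_finite_set _ _ (supp f `|` supp g)); last by rewrite finite_setU.
move=> s; rewrite /supp /= => h.
have [f0|] := eqVneq (f s) 0; last by left.
have [g0|] := eqVneq (g s) 0; last by right.
by move: h; rewrite -[X in X != _]/(k * f s + g s) f0 g0 mulr0 addr0 eqxx.
Qed.

HB.instance Definition _ :=
  GRing.isSubmodClosed.Build R (S -> R^o) finsupp_pred finsupp_submod_closed.

(* The free R-module on S: the finitely supported functions S -> R. *)
Record freemod := Freemod {
  coef :> S -> R^o;
  coefP : coef \in finsupp_pred }.

HB.instance Definition _ := [isSub for coef].
HB.instance Definition _ := [Choice of freemod by <:].
HB.instance Definition _ := [SubChoice_isSubLmodule of freemod by <:].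

Lemma freemod_eq (x y : freemod) : x =1 y -> x = y.
Proof. by move=> xy; apply: val_inj; exact: funext. Qed.

Lemma freemodP (x : freemod) : finite_set (supp x).
Proof. by apply/asboolP; exact: (coefP x). Qed.

Lemma freemodD (x y : freemod) s : (x + y) s = x s + y s.
Proof. by []. Qed.

Lemma freemodZ k (x : freemod) s : (k *: x) s = k * x s.
Proof. by []. Qed.

Fact free_gen_subproof (s : S) :
  (fun s' => (s' == s)%:R : R^o) \in finsupp_pred.
Proof.
apply/asboolP/(@sub_finite_set _ _ [set s]) => // s'.
by rewrite /supp /=; have [->|_] := eqVneq s' s; rewrite // eqxx.
Qed.

Definition free_gen (s : S) : freemod := Freemod (free_gen_subproof s).

Definition free_ext (W : lmodType R) (f : S -> W) (x : freemod) : W :=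
  \sum_(s \in supp x) (x s : R) *: f s.

Lemma free_extE (W : lmodType R) (f : S -> W) (x : freemod) (A : {fset S}) :
  supp x `<=` [set` A] -> free_ext f x = \sum_(s <- A) (x s : R) *: f s.
Proof.
move=> xA; rewrite [RHS]fsbig_seq ?fset_uniq //; apply: fsbig_widen => // s [_] /=.
by rewrite /supp /= => /negP; rewrite negbK => /eqP ->; rewrite scale0r.
Qed.

Lemma free_ext_linear (W : lmodType R) (f : S -> W) : linear (free_ext f).
Proof.
move=> k x y; pose A := (fset_set (supp x) `|` fset_set (supp y))%fset.
have xA : supp x `<=` [set` A].
  by move=> s xs; rewrite /= inE in_fset_set ?mem_set //; exact: freemodP.
have yA : supp y `<=` [set` A].
  move=> s xs; rewrite /= inE orbC in_fset_set ?mem_set //; exact: freemodP.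
have xyA : supp (k *: x + y) `<=` [set` A].
  move=> s; rewrite /supp /= -[X in X != _]/(k * x s + y s) => h.
  have [x0|x0] := eqVneq (x s) 0; last exact: xA.
  have [y0|y0] := eqVneq (y s) 0; last exact: yA.
  by move: h; rewrite x0 y0 mulr0 addr0 eqxx.
rewrite (free_extE _ xA) (free_extE _ yA) (free_extE _ xyA).
rewrite scaler_sumr -big_split /=; apply: eq_bigr => s _.
by rewrite -[X in X *: _]/(k * x s + y s : R) scalerDl scalerA.
Qed.

HB.instance Definition _ (W : lmodType R) (f : S -> W) :=
  GRing.isLinear.Build R freemod W *:%R (free_ext f) (free_ext_linear f).

Lemma free_ext_gen (W : lmodType R) (f : S -> W) s :
  free_ext f (free_gen s) = f s.
Proof.
rewrite (@free_extE _ _ _ [fset s]%fset) ?big_seq_fset1 /= ?eqxx ?scale1r //.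
by move=> s'; rewrite /supp /= inE; case: (s' == s) => //; rewrite eqxx.
Qed.

Lemma freemod_sum (x : freemod) : x = free_ext free_gen x.
Proof.
have xA : supp x `<=` [set` fset_set (supp x)].
  by move=> s xs; rewrite /= in_fset_set ?mem_set //; exact: freemodP.
apply: freemod_eq => t; rewrite (free_extE _ xA).
have cE (r : seq S) (F : S -> freemod) :
    (\sum_(i <- r) F i) t = \sum_(i <- r) F i t.
  by elim/big_rec2: _ => // i y1 y2 _ <-.
rewrite cE; have [xt|xt] := eqVneq (x t) 0.
  rewrite xt big1 // => s _; rewrite -[LHS]/(x s * (t == s)%:R).
  by have [<-|] := eqVneq t s; rewrite ?xt ?mul0r ?mulr0.
have tA : t \in fset_set (supp x) by exact: xA.
rewrite (bigD1_seq t) ?fset_uniq //= big1 => [|s /negPf st].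
  by rewrite -[RHS]/(x t * (t == t)%:R + 0) eqxx mulr1 addr0.
by rewrite -[LHS]/(x s * (t == s)%:R) eq_sym st mulr0.
Qed.

Lemma free_ext_uniq (W : lmodType R) (g h : {linear freemod -> W}) :
  (forall s, g (free_gen s) = h (free_gen s)) -> g =1 h.
Proof.
move=> gh x; rewrite [x]freemod_sum /free_ext fsbig_finite; last exact: freemodP.
by rewrite !linear_sum; apply: eq_bigr => s _; rewrite !linearZ /= gh.
Qed.

End FreeModule.

Section Tensor.
Variables (R : comPzRingType) (A B : lmodType R).
Local Notation F := (freemod R (Choice.clone (A * B)%type _)).

Definition bilinear_map (W : lmodType R) (f : A -> B -> W) :=
  (forall b, linear (f^~ b)) /\ (forall a, linear (f a)).

Definition pair_gen (a : A) (b : B) : F := free_gen R (a, b).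

Definition tensor_rel : set (F) := [set r |
  (exists k a a' b, r = pair_gen (k *: a + a') b
                        - (k *: pair_gen a b + pair_gen a' b)) \/
  (exists k a b b', r = pair_gen a (k *: b + b')
                        - (k *: pair_gen a b + pair_gen a b'))].

(* The intersection of all submodules containing tensor_rel. *)
Definition tensor_ker : {pred F} := [pred x |
  `[< forall P : {pred F}, submod_closed P ->
        (forall r, tensor_rel r -> r \in P) -> x \in P >]].

Lemma tensor_ker_submod_closed : submod_closed tensor_ker.
Proof.
split=> [|k x y]; first by apply/asboolP => P [].
move=> /asboolP xK /asboolP yK; apply/asboolP => P [P0 PD] rP.
by apply: (PD k x y); [apply: xK|apply: yK].
Qed.

HB.instance Definition _ := GRing.isSubmodClosed.Build R
  (F) tensor_ker tensor_ker_submod_closed.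

Definition tensor := Quotient.quot tensor_ker.

HB.instance Definition _ := GRing.Zmodule.on tensor.

Definition tensor_pi (x : F) : tensor := \pi_tensor%qT x.

Lemma tensor_piP x y : tensor_pi x = tensor_pi y <-> x - y \in tensor_ker.
Proof.
by rewrite Quotient.idealrBE; split=> [/eqP|/eqP].
Qed.

Lemma tensor_reprK t : tensor_pi (repr t) = t.
Proof. exact: reprK. Qed.

Lemma tensor_piD : {morph tensor_pi : x y / x + y}.
Proof. by move=> x y; rewrite /tensor_pi raddfD. Qed.

Definition tensor_scale (k : R) (t : tensor) : tensor := tensor_pi (k *: repr t).

Lemma tensor_piZ k x : tensor_pi (k *: x) = tensor_scale k (tensor_pi x).
Proof.
apply/tensor_piP; rewrite -scalerBr rpredZ //; apply/tensor_piP.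
by rewrite tensor_reprK.
Qed.

Fact tensor_scaleA k l t :
  tensor_scale k (tensor_scale l t) = tensor_scale (k * l) t.
Proof. by rewrite -[t]tensor_reprK -!tensor_piZ scalerA. Qed.

Fact tensor_scale1 : left_id 1 tensor_scale.
Proof. by move=> t; rewrite -[t]tensor_reprK -tensor_piZ scale1r. Qed.

Fact tensor_scaleDr : right_distributive tensor_scale +%R.
Proof.
move=> k t u; rewrite -[t]tensor_reprK -[u]tensor_reprK -tensor_piD.
by rewrite -!tensor_piZ scalerDr tensor_piD.
Qed.

Fact tensor_scaleDl t : {morph tensor_scale^~ t : k l / k + l}.
Proof.
by move=> k l; rewrite -[t]tensor_reprK -!tensor_piZ scalerDl tensor_piD.
Qed.

HB.instance Definition _ := GRing.Zmodule_isLmodule.Build R tensor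
  tensor_scaleA tensor_scale1 tensor_scaleDr tensor_scaleDl.

Definition tens (a : A) (b : B) : tensor := tensor_pi (pair_gen a b).

Lemma tensor_pi_linear : linear tensor_pi.
Proof. by move=> k x y; rewrite tensor_piD tensor_piZ. Qed.

HB.instance Definition _ := GRing.isLinear.Build R
  (F) tensor *:%R tensor_pi tensor_pi_linear.

Lemma tens_bilinear : bilinear_map tens.
Proof.
split=> [b k a a'|a k b b']; rewrite /tens -linearP;
  apply/tensor_piP/asboolP => P _; apply.
- by left; exists k, a, a', b.
- by right; exists k, a, b, b'.
Qed.

(* Linear, with value f a b on tens a b, when f is bilinear; otherwise the value
   depends on the chosen representatives. *)
Definition tens_lift (W : lmodType R) (f : A -> B -> W) (t : tensor) : W :=
  free_ext (fun p : A * B => f p.1 p.2) (repr t).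

Section Lift.
Variables (W : lmodType R) (f : A -> B -> W).
Hypothesis f_bilin : bilinear_map f.

Lemma tens_lift_pi x :
  tens_lift f (tensor_pi x) = free_ext (fun p : A * B => f p.1 p.2) x.
Proof.
pose E : {linear F -> W} :=
  free_ext (fun p : A * B => f p.1 p.2).
apply/eqP; rewrite -subr_eq0 -[X in X == 0]/(E (repr (tensor_pi x)) - E x).
rewrite -raddfB.
have /asboolP/(_ [pred u | E u == 0]) : repr (tensor_pi x) - x \in tensor_ker.
  by apply/tensor_piP; rewrite tensor_reprK.
rewrite inE /=; apply.
  split=> [|k u v]; rewrite !inE; first by rewrite raddf0.
  by move=> /eqP u0 /eqP v0; rewrite linearP /= u0 v0 scaler0 addr0.
case: f_bilin => fl fr.
move=> r [[k [a [a' [b ->]]]]|[k [a [b [b' ->]]]]];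
  by rewrite inE raddfB /= linearP /= /pair_gen !free_ext_gen /= ?fl ?fr subrr.
Qed.

Lemma tens_liftE a b : tens_lift f (tens a b) = f a b.
Proof. by rewrite tens_lift_pi free_ext_gen. Qed.

Lemma tens_lift_linear : linear (tens_lift f).
Proof.
move=> k t u; rewrite -[t]tensor_reprK -[u]tensor_reprK -linearP.
by rewrite !tens_lift_pi linearP.
Qed.

End Lift.

Lemma tens_lift_uniq (W : lmodType R) (g h : {linear tensor -> W}) :
  (forall a b, g (tens a b) = h (tens a b)) -> g =1 h.
Proof.
move=> gh t; rewrite -[t]tensor_reprK.
have /(_ _)/= := @free_ext_uniq R _ W
  (g \o @tensor_pi : {linear _ -> _}) (h \o @tensor_pi : {linear _ -> _}).
by apply=> -[a b]; exact: gh.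
Qed.

End Tensor.

Notation "a ⊗ b" := (tens a b) (at level 39, left associativity) : ring_scope.

Section LieCobracket.
Variables (R : comPzRingType) (A : lmodType R).
Local Notation A2 := (GRing.Lmodule.clone R (tensor A A) _).
Local Notation A3 := (GRing.Lmodule.clone R (tensor A A2) _).

Definition tens_perm : A2 -> A2 :=
  tens_lift (fun x y => y ⊗ x).

Definition tens_tau : A3 -> A3 :=
  tens_lift (fun x => tens_lift (fun y z => z ⊗ (x ⊗ y))).

Definition tens_id_map (f : {linear A -> A2}) :
    A2 -> A3 :=
  tens_lift (fun x y => x ⊗ f y).

(* The triple tensor product is A ⊗ (A ⊗ A), so tens_id_map nu is id ⊗ nu. *)
Definition lie_cobracket (nu : {linear A -> A2}) : Prop :=
  (forall a, tens_perm (nu a) = - nu a) /\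
  (forall a, let t := tens_id_map nu (nu a) in
             t + tens_tau t + tens_tau (tens_tau t) = 0).

Lemma tens_perm_bilinear : bilinear_map (fun x y : A => y ⊗ x).
Proof.
by have [l r] := tens_bilinear A A; split=> [b k a a'|a k b b'];
  rewrite ?l ?r.
Qed.

Lemma tens_permE x y : tens_perm (x ⊗ y) = y ⊗ x.
Proof. by rewrite /tens_perm tens_liftE //; exact: tens_perm_bilinear. Qed.

Lemma tens_tau_bilinear2 x : bilinear_map (fun y z : A => z ⊗ (x ⊗ y) : A3).
Proof.
have [l r] := tens_bilinear A A; have [l' r'] := tens_bilinear A (tensor A A).
by split=> [b k a a'|a k b b']; rewrite ?r ?r' ?l'.
Qed.

Lemma tens_tau_bilinear :
  bilinear_map (fun x : A => tens_lift (fun y z : A => z ⊗ (x ⊗ y) : A3)).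
Proof.
have [l r] := tens_bilinear A A; have [l' r'] := tens_bilinear A (tensor A A).
split=> [t k a a'|a]; last exact: tens_lift_linear (tens_tau_bilinear2 a).
rewrite /tens_lift /free_ext !fsbig_finite; [|exact: freemodP..].
rewrite scaler_sumr -big_split; apply: eq_bigr => -[y z] _ /=.
by rewrite l r' scalerDr !scalerA mulrC.
Qed.

Lemma tens_tauE x y z : tens_tau (x ⊗ (y ⊗ z)) = z ⊗ (x ⊗ y).
Proof.
rewrite /tens_tau tens_liftE; last exact: tens_tau_bilinear.
by rewrite tens_liftE //; exact: tens_tau_bilinear2.
Qed.

Lemma tens_id_map_bilinear (f : {linear A -> A2}) :
  bilinear_map (fun x y => x ⊗ f y : A3).
Proof.
have [l r] := tens_bilinear A (tensor A A).
by split=> [b k a a'|a k b b']; rewrite ?l // linearP r.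
Qed.

Lemma tens_id_mapE (f : {linear A -> A2}) x y :
  tens_id_map f (x ⊗ y) = x ⊗ f y.
Proof. by rewrite /tens_id_map tens_liftE //; exact: tens_id_map_bilinear. Qed.

HB.instance Definition _ := GRing.isLinear.Build R _ _ *:%R tens_perm
  (tens_lift_linear tens_perm_bilinear).

HB.instance Definition _ := GRing.isLinear.Build R _ _ *:%R tens_tau
  (tens_lift_linear tens_tau_bilinear).

HB.instance Definition _ f := GRing.isLinear.Build R _ _ *:%R (tens_id_map f)
  (tens_lift_linear (tens_id_map_bilinear f)).

End LieCobracket.

Section Strings.
Variable T : realType.

(* Every core circle is taken to be the unit circle of the plane T^2 with its
   subspace topology and its counterclockwise orientation. *)
Definition unit_circle : set (T * T) := [set z | z.1 ^+ 2 + z.2 ^+ 2 = 1].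

Local Notation circle := (set_type unit_circle).

(* Three points of the circle are pairwise distinct and met in the order a, b, c
   in the positive direction iff the triangle abc has positive signed area. *)
Definition ccw (a b c : circle) : bool :=
  let: (p, q, r) := (val a, val b, val c) in
  0 < (q.1 - p.1) * (r.2 - p.2) - (q.2 - p.2) * (r.1 - p.1).

Definition open_arc (a b : circle) : {pred circle} := [pred x | ccw a x b].

(* The closed arc from a to b in the positive direction, for a != b. *)
Definition arc (a b : circle) : {pred circle} :=
  [pred x | [|| x == a, x == b | x \in open_arc a b]].

Definition arrow := (circle * circle)%type.

Definition endpoints (A : seq arrow) : seq circle :=
  flatten [seq [:: e.1; e.2] | e <- A].

Record vstring := VString {
  arr : {fset arrow};
  arr_uniq : uniq (endpoints arr) }.

Lemma mem_endpoints (A : seq arrow) (p : circle) :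
  reflect (exists2 e, e \in A & p = e.1 \/ p = e.2) (p \in endpoints A).
Proof.
apply: (iffP flatten_mapP) => -[e eA]; last first.
  by case=> ->; exists e; rewrite ?inE ?eqxx ?orbT.
by rewrite !inE => /orP[]/eqP ->; exists e => //; [left|right].
Qed.

Fact uniq_endpoints_filter (P : pred arrow) (A : seq arrow) :
  uniq (endpoints A) -> uniq (endpoints [seq e <- A | P e]).
Proof.
suff : subseq (endpoints [seq e <- A | P e]) (endpoints A) by apply: subseq_uniq.
elim: A => // e A IH; rewrite [seq.filter _ _]/=; case: ifP => _.
  exact: (cat_subseq (subseq_refl [:: e.1; e.2]) IH).
exact: (subseq_trans IH (suffix_subseq [:: e.1; e.2] _)).
Qed.

Fact restrict_subproof (alpha : vstring) (D : {pred circle}) :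
  uniq (endpoints [fset e in arr alpha | (e.1 \in D) && (e.2 \in D)]%fset).
Proof.
set P := fun e : arrow => (e.1 \in D) && (e.2 \in D).
have /perm_uniq -> : perm_eq (endpoints [fset e in arr alpha | P e]%fset)
    (endpoints [seq e <- arr alpha | P e]).
  apply/perm_flatten/perm_map/uniq_perm; rewrite ?filter_uniq ?fset_uniq //.
  by move=> e; rewrite mem_filter !inE andbC.
exact/uniq_endpoints_filter/arr_uniq.
Qed.

Definition restrict (alpha : vstring) (D : {pred circle}) : vstring :=
  VString (restrict_subproof alpha D).

(* The strings alpha^1_e and alpha^2_e, on the same core circle as alpha. *)
Definition string1 (alpha : vstring) (e : arrow) : vstring :=
  restrict alpha (open_arc e.1 e.2).

Definition string2 (alpha : vstring) (e : arrow) : vstring :=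
  restrict alpha (open_arc e.2 e.1).

Definition orientation_preserving_homeo (h : circle -> circle) : Prop :=
  (exists g : circle -> circle,
     [/\ cancel h g, cancel g h, continuous h & continuous g]) /\
  (forall a b c, ccw a b c -> ccw (h a) (h b) (h c)).

Definition homeo_strings (alpha beta : vstring) : Prop :=
  exists2 h, orientation_preserving_homeo h &
    arr beta = [fset (h e.1, h e.2) | e in arr alpha]%fset.

Definition disjoint_preds (I J : {pred circle}) : Prop :=
  forall p, p \in I -> p \notin J.

Definition free_arc (alpha : vstring) (I : {pred circle}) : Prop :=
  disjoint_preds (mem (endpoints (arr alpha))) I.

Definition move_a (alpha beta : vstring) : Prop :=
  exists a b, [/\ a != b, free_arc alpha (arc a b)
                & arr beta = ((a, b) |` arr alpha)%fset].

Definition move_b (alpha beta : vstring) : Prop :=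
  exists p q r s a a' b b',
    [/\ p != q /\ r != s,
        disjoint_preds (arc p q) (arc r s),
        free_arc alpha (arc p q) /\ free_arc alpha (arc r s),
        ((a, a') = (p, q) \/ (a, a') = (q, p)) /\
        ((b, b') = (r, s) \/ (b, b') = (s, r))
      & arr beta = ((a, b) |` ((b', a') |` arr alpha))%fset].

(* a1, b1, c1 stand for a^+, b^+, c^+; the disjointness of the three arcs makes
   the three arrows pairwise distinct. *)
Definition move_c (alpha beta : vstring) : Prop :=
  exists a a1 b b1 c c1,
    [/\ [/\ (a1, b) \in arr alpha, (b1, c) \in arr alpha
          & (c1, a) \in arr alpha],
        [/\ disjoint_preds (arc a a1) (arc b b1),
            disjoint_preds (arc b b1) (arc c c1)
          & disjoint_preds (arc c c1) (arc a a1)],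
        (forall p, p \in endpoints (arr alpha) ->
           p \notin [:: a; a1; b; b1; c; c1] ->
           [/\ p \notin arc a a1, p \notin arc b b1 & p \notin arc c c1])
      & arr beta = ((arr alpha `\` [fset (a1, b); (b1, c); (c1, a)])
                      `|` [fset (a, b1); (b, c1); (c, a1)])%fset].

Definition string_step (alpha beta : vstring) : Prop :=
  [\/ homeo_strings alpha beta, move_a alpha beta, move_b alpha beta
    | move_c alpha beta].

Definition homotopic : vstring -> vstring -> Prop :=
  clos_refl_sym_trans vstring string_step.

Definition trivial_string (alpha : vstring) : Prop := arr alpha = fset0.

Definition homotopically_trivial (alpha : vstring) : Prop :=
  exists2 beta, trivial_string beta & homotopic alpha beta.

Definition homotopy_class (alpha : vstring) : set vstring := homotopic alpha.

Definition nontrivial_classes : set (set vstring) :=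
  homotopy_class @` [set alpha | ~ homotopically_trivial alpha].

Definition S0 : choiceType := Choice.clone (set_type nontrivial_classes) _.

Definition nontrivial_class (alpha : vstring)
    (nt : ~ homotopically_trivial alpha) : S0 :=
  SigSub (mem_set (imageP homotopy_class nt)).

Variable R : comPzRingType.

Definition A0 : lmodType R := GRing.Lmodule.clone R (freemod R S0) _.

(* The element <alpha> of A0. *)
Definition string_gen (alpha : vstring) : A0 :=
  match pselect (homotopically_trivial alpha) with
  | left _ => 0
  | right nt => free_gen R (nontrivial_class nt)
  end.

Definition cobracket_sum (alpha : vstring) : tensor A0 A0 :=
  \sum_(e <- arr alpha)
     (string_gen (string1 alpha e) ⊗ string_gen (string2 alpha e)
      - string_gen (string2 alpha e) ⊗ string_gen (string1 alpha e)).

End Strings.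

(* Main.v *)
Require Import Defs.
From HB Require Import structures.
From mathcomp Require Import all_boot all_order all_algebra finmap.
From mathcomp Require Import all_classical all_reals topology normedtype.
From mathcomp Require Import ring lra.
From Stdlib Require Import Relations.Relation_Operators.
(* From here on arc is an arc of the circle, not one of a cyclic sequence. *)
Import Defs.

(** The value on a string is the sum over its arrows e of the wedge L ⊗ L' - L' ⊗ L
    of the two loops of e: the strings L and L' formed by the arrows inside one and
    the other of the two arcs into which e cuts the circle.

    Invariance. An arrow which is not touched by a move has both endpoints outside
    the short arcs of the move, so each of these arcs lies in one of the two loops
    of the arrow; hence the move restricts to each loop, where it is a move of the
    same kind, trivial, or, for move (c), the sliding of one arrow along two free
    arcs (restrict_a, restrict_b, restrict_c). Sliding is obtained from move
    (b) and its inverse (slide_arrow), so no isotopy of the circle has to be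
    constructed. It remains to compare the terms of the touched arrows. The arrow
    added by move (a) has an empty loop. The two arrows added by move (b) have the
    same loops up to homotopy, in opposite order, so their wedges cancel
    (move_b_loops). Under move (c) each of the three arrows keeps its two loops
    up to homotopy: one of the loops may acquire or lose the two other arrows, but
    these then form a pair that an inverse move (b) removes (move_c_loops).
    All positions are decided by the cyclic order of the circle, which ccw_cut
    identifies with the order of a line after cutting the circle at any point.

    Co-Jacobi. The iterated cobracket is a signed sum over pairs of arrows e, f
    where f lies in one loop of e, hence e lies in one loop of f. Such a pair
    divides the string into three: the loop P of e away from f, the loop Q of f
    away from e, and the middle part M. The pair (e, f) contributes
    P ⊗ Q ⊗ M - P ⊗ M ⊗ Q up to a sign symmetric in e and f
    (iterated_config), and the pair (f, e) contributes
    Q ⊗ P ⊗ M - Q ⊗ M ⊗ P with the same sign. After summing over cyclic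
    permutations these four terms cancel two by two (sum_config). *)

Set Implicit Arguments.
Unset Strict Implicit.
Unset Printing Implicit Defensive.

Import Order.TTheory GRing.Theory Num.Theory.
Local Open Scope ring_scope.

(** * The cyclic order of the circle *)

Notation circle T := (set_type (@unit_circle T)).

Section CyclicOrder.
Variable T : realType.
Implicit Types (p x y z : circle T) (u v w : T).

Definition cyc (u v w : T) : bool :=
  [|| (u < v) && (v < w), (v < w) && (w < u) | (w < u) && (u < v)].

Lemma cyc_prod u v w : cyc u v w = (0 < (v - u) * (w - v) * (w - u)).
Proof.
rewrite /cyc -mulrA; have [uv|vu|->] := ltgtP u v.
- rewrite pmulr_rgt0 ?subr_gt0 //.
  have [vw|wv|vw] := ltgtP v w.
  + by rewrite pmulr_rgt0 ?subr_gt0 //=; lra.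
  + by rewrite nmulr_rgt0 ?subr_lt0 //= andbT.
  + by rewrite -vw subrr mul0r ltxx (lt_gtF uv).
- rewrite nmulr_rgt0 ?subr_lt0 //=.
  have [vw|wv|vw] := ltgtP v w.
  + by rewrite pmulr_rlt0 ?subr_gt0 //= subr_lt0 andbF orbF.
  + by rewrite nmulr_rlt0 ?subr_lt0 //= subr_gt0; lra.
  + by rewrite -vw subrr mul0r ltxx andbF.
- by rewrite subrr mul0r !ltxx /=; case: ltgtP.
Qed.

Lemma circleP x : (val x).1 ^+ 2 + (val x).2 ^+ 2 = 1.
Proof. exact: (set_valP x). Qed.

(** With tangent, the coordinates of x in the orthonormal frame at p formed by
    the inward normal and the clockwise tangent. *)
Definition height p x : T := 1 - ((val p).1 * (val x).1 + (val p).2 * (val x).2).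
Definition tangent p x : T := (val p).2 * (val x).1 - (val p).1 * (val x).2.

Lemma height_gt0 p x : x != p -> 0 < height p x.
Proof.
move=> xp.
have hE : 2 * height p x = ((val x).1 - (val p).1) ^+ 2
                            + ((val x).2 - (val p).2) ^+ 2.
  by rewrite /height; have := circleP p; have := circleP x; lra.
have h0 : 0 <= height p x.
  have := sqr_ge0 ((val x).1 - (val p).1).
  have := sqr_ge0 ((val x).2 - (val p).2); lra.
rewrite lt_neqAle h0 andbT; apply: contra_neq xp => h00.
move: hE; rewrite -h00 mulr0 => /esym/eqP.
rewrite paddr_eq0 ?sqr_ge0 // !sqrf_eq0 !subr_eq0 => /andP[/eqP e1 /eqP e2].
apply: val_inj; case: (val x) (val p) e1 e2 => [? ?] [? ?] /= -> ->; done.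
Qed.

Lemma ccw_det p x y z :
  ccw x y z = (0 < (tangent p z - tangent p x) * (height p y - height p x)
                   - (tangent p y - tangent p x) * (height p z - height p x)).
Proof.
rewrite /ccw; congr (0 < _); rewrite /tangent /height.
have := circleP p; move: (val p) (val x) (val y) (val z).
move=> [p1 p2] [x1 x2] [y1 y2] [z1 z2] /= h.
transitivity ((p1 ^+ 2 + p2 ^+ 2)
  * ((y1 - x1) * (z2 - x2) - (y2 - x2) * (z1 - x1))); last by ring.
by rewrite h mul1r.
Qed.

(** The stereographic projection of the circle from p. *)
Definition slope p x : T := tangent p x / height p x.

(** The circle has equation tangent^2 + height^2 = 2 height, so the slope
    determines both coordinates rationally. *)
Lemma slopeE p x : x != p ->
  height p x = 2 / (1 + slope p x ^+ 2) /\ tangent p x = slope p x * height p x.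
Proof.
move=> xp; have h0 := height_gt0 xp; have h0' := lt0r_neq0 h0.
have sE : tangent p x = slope p x * height p x by rewrite divfK.
split=> //.
have : tangent p x ^+ 2 = height p x * (2 - height p x).
  rewrite /tangent /height; have := circleP p; have := circleP x.
  move: (val p) (val x) => [p1 p2] [x1 x2] /= hx hp.
  transitivity ((p1 ^+ 2 + p2 ^+ 2) * (x1 ^+ 2 + x2 ^+ 2)
    - (p1 * x1 + p2 * x2) ^+ 2); first by ring.
  by rewrite hx hp; ring.
rewrite sE exprMn expr2 [height p x ^+ 2]expr2 => e.
have {}e : slope p x * slope p x * height p x = 2 - height p x.
  by apply: (mulfI h0'); rewrite -e; ring.
have pos : 0 < 1 + slope p x ^+ 2 by have := sqr_ge0 (slope p x); lra.
apply: (canRL (mulfK (lt0r_neq0 pos))).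
by rewrite mulrDr mulr1 expr2 [X in _ + X]mulrC e; ring.
Qed.

(** Substituting the rational parametrisation turns the signed area into a
    positive multiple of the product of the differences of the slopes. *)
Lemma ccw_slope p x y z : x != p -> y != p -> z != p ->
  ccw x y z = cyc (slope p x) (slope p y) (slope p z).
Proof.
move=> xp yp zp; rewrite cyc_prod (ccw_det p).
have [-> ->] := slopeE xp; have [-> ->] := slopeE yp; have [-> ->] := slopeE zp.
move: (slope p x) (slope p y) (slope p z) => u v w.
have pos t : 0 < 1 + t ^+ 2 :> T by have := sqr_ge0 t; lra.
have nz t : 1 + t ^+ 2 != 0 :> T by exact: lt0r_neq0.
set P := _ * _ * _.
have cpos : 0 < 4 / ((1 + u ^+ 2) * (1 + v ^+ 2) * (1 + w ^+ 2)).
  by rewrite divr_gt0 ?mulr_gt0.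
rewrite -(pmulr_rgt0 P cpos) /P; congr (0 < _).
have := nz u; have := nz v; have := nz w => hw hv hu; field.
by rewrite hu hv hw.
Qed.

Lemma ccw_base p y z : y != p -> z != p ->
  ccw p y z = (slope p y < slope p z).
Proof.
move=> yp zp; rewrite (ccw_det p).
have -> : tangent p p = 0 by rewrite /tangent mulrC subrr.
have -> : height p p = 0.
  by rewrite /height -!expr2 circleP subrr.
have h1 := height_gt0 yp; have h2 := height_gt0 zp.
have [_ ->] := slopeE yp; have [_ ->] := slopeE zp.
rewrite -[RHS]subr_gt0 -(pmulr_rgt0 _ (mulr_gt0 h1 h2)); congr (0 < _); ring.
Qed.

Lemma slope_inj p x y : x != p -> y != p -> slope p x = slope p y -> x = y.
Proof.
move=> xp yp e.
have [h1 s1] := slopeE xp; have [h2 s2] := slopeE yp.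
have hE : height p x = height p y by rewrite h1 h2 e.
have s : tangent p x = tangent p y by rewrite s1 s2 hE e.
move: hE s; rewrite /height /tangent => /(addrI 1)/oppr_inj h s.
have rec z : val z = ((val p).1 * ((val p).1 * (val z).1 + (val p).2 * (val z).2)
    + (val p).2 * ((val p).2 * (val z).1 - (val p).1 * (val z).2),
    (val p).2 * ((val p).1 * (val z).1 + (val p).2 * (val z).2)
    - (val p).1 * ((val p).2 * (val z).1 - (val p).1 * (val z).2)).
  have := circleP p; move: (val p) (val z) => [p1 p2] [z1 z2] /= hp.
  by congr pair; [rewrite -[LHS]mul1r|rewrite -[LHS]mul1r]; rewrite -hp; ring.
by apply: val_inj; rewrite (rec x) (rec y) h s.
Qed.

(** The circle cut open at p: stereographic projection embeds the circle minus p
    in the line in an order-preserving way, and an increasing bijection from the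
    line to the positive half-line leaves room for p below all other points. *)
Definition cut p x : T :=
  if x == p then 0
  else if 0 <= slope p x then 1 + slope p x else (1 - slope p x)^-1.

Lemma cut_lt p x y : x != p -> y != p ->
  (cut p x < cut p y) = (slope p x < slope p y).
Proof.
move=> xp yp; rewrite /cut (negPf xp) (negPf yp).
move: (slope p x) (slope p y) => u v.
have inv (t : T) : t < 0 -> 0 < (1 - t)^-1 < 1.
  by move=> t0; rewrite invr_gt0 invf_lt1; lra.
have [u0|/[dup] u0 /inv/andP[? ?]] := leP 0 u;
  have [v0|/[dup] v0 /inv/andP[? ?]] := leP 0 v; [lra|lra|lra|].
by rewrite ltf_pV2 ?posrE; lra.
Qed.

Lemma cut_gt0 p x : x != p -> cut p p < cut p x.
Proof.
move=> xp; rewrite /cut eqxx (negPf xp); case: ifP => [|/negbT]; first lra.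
by rewrite -ltNge invr_gt0; lra.
Qed.

Lemma cut_inj p : injective (cut p).
Proof.
move=> x y e.
have [xp|xp] := eqVneq x p; have [yp|yp] := eqVneq y p.
- by rewrite xp yp.
- by have := cut_gt0 yp; rewrite -e xp ltxx.
- by have := cut_gt0 xp; rewrite e yp ltxx.
apply: (slope_inj xp yp); apply/le_anti/andP; rewrite !leNgt.
by rewrite -!cut_lt // e ltxx.
Qed.

Lemma ccw_same x y : [/\ ccw x x y = false, ccw x y y = false & ccw x y x = false].
Proof.
by rewrite /ccw; split; apply/negbTE; rewrite -leNgt le_eqVlt;
  apply/orP; left; apply/eqP; ring.
Qed.

Lemma ccw_rot x y z : ccw x y z = ccw y z x.
Proof. by rewrite /ccw; congr (0 < _); ring. Qed.

(** The cyclic order is that of a line closed up, wherever the circle is cut.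
    Cutting at a well-chosen point reduces every question on arcs below to
    linear inequalities. *)
Lemma ccw_cut p x y z : ccw x y z = cyc (cut p x) (cut p y) (cut p z).
Proof.
have cyc_rot (u v w : T) : cyc u v w = cyc v w u.
  by rewrite /cyc orbC -!orbA.
have base y' z' : ccw p y' z' = cyc (cut p p) (cut p y') (cut p z').
  have [->|yp] := eqVneq y' p.
    by have [-> _ _] := ccw_same p z'; rewrite /cyc ltxx; lra.
  have [->|zp] := eqVneq z' p.
    by have [_ _ ->] := ccw_same p y'; rewrite /cyc ltxx; lra.
  rewrite ccw_base // -cut_lt // /cyc.
  by have := cut_gt0 yp; have := cut_gt0 zp; lra.
have [->|xp] := eqVneq x p; first exact: base.
have [->|yp] := eqVneq y p.
  by rewrite ccw_rot cyc_rot ccw_rot cyc_rot -ccw_rot base -cyc_rot.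
have [->|zp] := eqVneq z p; first by rewrite -ccw_rot -cyc_rot base.
by rewrite (ccw_slope xp yp zp) /cyc !cut_lt.
Qed.

(** Stereographic projection from x is increasing and onto, so a point of slope
    less than that of y exists and lies between x and y. *)
Lemma ccw_between x y : x != y -> exists z, ccw x z y.
Proof.
move=> xy; pose t := slope x y - 1.
have pos : 0 < 1 + t ^+ 2 by have := sqr_ge0 t; lra.
pose n := 2 / (1 + t ^+ 2).
have nE : n * (1 + t ^+ 2) = 2 by rewrite divfK // lt0r_neq0.
have n0 : 0 < n by rewrite divr_gt0.
have hx := circleP x.
pose zz := ((val x).1 * (1 - n) + (val x).2 * (t * n),
            (val x).2 * (1 - n) - (val x).1 * (t * n)).
have zc : zz \in @unit_circle T.
  rewrite inE /unit_circle /=.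
  transitivity (((val x).1 ^+ 2 + (val x).2 ^+ 2) * (1 - n * (2 - n * (1 + t ^+ 2)))).
    by ring.
  by rewrite hx nE subrr mulr0 subr0 mulr1.
pose z : circle T := SigSub zc.
have hz : height x z = n.
  rewrite /height /=; transitivity (1 - ((val x).1 ^+ 2 + (val x).2 ^+ 2) * (1 - n)).
    by ring.
  by rewrite hx; ring.
have sz : tangent x z = t * n.
  rewrite /tangent /=; transitivity (((val x).1 ^+ 2 + (val x).2 ^+ 2) * (t * n)).
    by ring.
  by rewrite hx mul1r.
have zx : z != x.
  by apply: contraTneq n0 => e; rewrite -hz e /height -!expr2 circleP subrr ltxx.
have yx : y != x by rewrite eq_sym.
exists z; rewrite (ccw_base zx yx).
by rewrite /slope hz sz mulfK ?lt0r_neq0 // -/(slope x y) /t; lra.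
Qed.

End CyclicOrder.

(** * Arcs *)

Section Arcs.
Variable T : realType.
Implicit Types (p x y z a b : circle T).

Lemma arcE a b x : (x \in arc a b) = [|| x == a, x == b | ccw a x b].
Proof. by []. Qed.

Lemma cut_eq p x y : (x == y) = (cut p x == cut p y).
Proof. by rewrite (inj_eq (@cut_inj T p)). Qed.

Lemma cut_min p x : cut p p <= cut p x.
Proof. by have [->//|/cut_gt0/ltW] := eqVneq x p. Qed.

Lemma ccw_cut0 p x y : ccw p x y = (cut p p < cut p x < cut p y).
Proof.
rewrite (ccw_cut p) /cyc; have := cut_min p x; have := cut_min p y.
move: (cut p p) (cut p x) (cut p y) => u v w; lra.
Qed.

Lemma arc_cut p q x : p != q -> (x \in arc p q) = (cut p x <= cut p q).
Proof.
move=> pq; rewrite arcE ccw_cut0 !(cut_eq p).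
have := cut_min p x; have : cut p p < cut p q by rewrite cut_gt0 // eq_sym.
move: (cut p p) (cut p x) (cut p q) => u v w; lra.
Qed.

Lemma ccw_neq a b c : ccw a b c -> [/\ a != b, b != c & a != c].
Proof.
have s := @ccw_same T; move=> h; split; apply: contraTN h => /eqP->.
- by have [-> _ _] := s b c.
- by have [_ -> _] := s a c.
- by have [_ _ ->] := s c b.
Qed.

(** Both ends of the arc u v lie outside the arc p q, so p q is contained in
    one of the two sides of the pair u, v. *)
Lemma arc_side u v p q x y : p != q -> u \notin arc p q -> v \notin arc p q ->
  x \in arc p q -> y \in arc p q -> ccw u x v = ccw u y v.
Proof.
move=> pq; rewrite !arc_cut // -!ltNge !(ccw_cut p) /cyc.
move: (cut p u) (cut p v) (cut p q) (cut p x) (cut p y) => u' v' q' x' y'.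
move=> qu qv xq yq.
have -> : (u' < x') = false by apply/negbTE; lra.
have -> : (u' < y') = false by apply/negbTE; lra.
have -> : (x' < v') by lra.
by have -> : (y' < v') by lra.
Qed.

Lemma arc_sub a x b : ccw a x b ->
  [/\ {subset arc a x <= arc a b}, {subset arc x b <= arc a b},
      b \notin arc a x & a \notin arc x b].
Proof.
move=> h; have [ax xb ab] := ccw_neq h.
move: h; rewrite ccw_cut0 => /andP[h1 h2]; split=> [y|y||].
- by rewrite !arc_cut //; lra.
- rewrite (arc_cut _ ab) arcE (ccw_cut a) /cyc.
  move=> /or3P[/eqP->|/eqP->|]; [exact: ltW|exact: lexx|].
  have := cut_min a y; move: (cut _ _) (cut _ _) (cut _ _) (cut _ _) h1 h2 => *; lra.
- by rewrite arc_cut // -ltNge.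
- rewrite arcE !negb_or ax ab (ccw_cut a) /cyc.
  by move: (cut _ _) (cut _ _) (cut _ _) h1 h2 => *; lra.
Qed.

Lemma disjoint_subarcs a b c d : ccw a c b -> ccw c d b ->
  disjoint_preds (arc a c) (arc d b).
Proof.
move=> acb cdb x; have [ac _ _] := ccw_neq acb.
rewrite (arc_cut _ ac) arcE !(cut_eq a) !(ccw_cut a).
move: acb cdb; rewrite ccw_cut0 (ccw_cut a) => /andP[] ; rewrite /cyc.
move: (cut a a) (cut a b) (cut a c) (cut a d) (cut a x) => a' b' c' d' x'.
move=> ? ? h ?; have /andP[? ?] : c' < d' < b' by move: h; lra.
rewrite !negb_or; apply/and3P; split; lra.
Qed.

End Arcs.

(** * Endpoints, and homotopies composed of several moves *)

Section VStrings.
Variable T : realType.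
Implicit Types (alpha beta gamma : vstring T) (e f : arrow T).
Implicit Types (a b x y : circle T) (D : {pred circle T}).

Lemma vstring_eq alpha beta : arr alpha = arr beta -> alpha = beta.
Proof.
case: alpha beta => A uA [B uB] /= AB; move: uB; rewrite -AB => uB.
by congr VString; exact: bool_irrelevance.
Qed.

Lemma endpoints_share (A : seq (arrow T)) e f x : uniq (endpoints A) ->
  e \in A -> f \in A -> x \in [:: e.1; e.2] -> x \in [:: f.1; f.2] -> e = f.
Proof.
elim: A => // g A IH; rewrite /endpoints /= -/(endpoints A).
move=> /and3P[]; rewrite inE negb_or => /andP[_ g1 g2 uA].
have no h : h \in A -> x \in [:: h.1; h.2] -> x \in [:: g.1; g.2] -> False.
  move=> hA xh xg; have : x \in endpoints A.
    apply/mem_endpoints; exists h => //; move: xh.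
    by rewrite !inE => /orP[]/eqP; [left|right].
  by move: xg; rewrite !inE => /orP[]/eqP->; apply/negP.
rewrite ![_ \in g :: A]inE => /predU1P[->|eA] /predU1P[->|fA] //; last exact: IH.
- by move=> xg xf; case: (no f).
- by move=> xe xg; case: (no e).
Qed.

Lemma arr_share alpha e f x : e \in arr alpha -> f \in arr alpha ->
  x \in [:: e.1; e.2] -> x \in [:: f.1; f.2] -> e = f.
Proof. exact/endpoints_share/arr_uniq. Qed.

Lemma arr_neq alpha e : e \in arr alpha -> e.1 != e.2.
Proof.
have := arr_uniq alpha; rewrite -[e \in arr alpha]/(e \in enum_fset (arr alpha)).
elim: (enum_fset _) => // g A IH; rewrite /endpoints /= -/(endpoints A) inE.
rewrite inE negb_or => /and3P[/andP[g12 _] _ uA] /predU1P[->//|]; exact: IH.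
Qed.

Lemma endpoint1 (A : seq (arrow T)) e : e \in A -> e.1 \in endpoints A.
Proof. by move=> eA; apply/mem_endpoints; exists e => //; left. Qed.

Lemma endpoint2 (A : seq (arrow T)) e : e \in A -> e.2 \in endpoints A.
Proof. by move=> eA; apply/mem_endpoints; exists e => //; right. Qed.

Lemma perm_endpoints_add (A : {fset arrow T}) f : f \notin A ->
  perm_eq (endpoints (f |` A)%fset) [:: f.1, f.2 & endpoints A].
Proof.
move=> fA; rewrite -[X in perm_eq _ X]/(endpoints (f :: A)).
apply/perm_flatten/perm_map/uniq_perm; rewrite ?fset_uniq //= ?fA ?fset_uniq //.
by move=> e; rewrite !inE.
Qed.

Lemma mem_endpoints_add (A : {fset arrow T}) f x :
  (x \in endpoints (f |` A)%fset) = [|| x == f.1, x == f.2 | x \in endpoints A].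
Proof.
apply/mem_endpoints/or3P => [[e]|].
  rewrite !inE => /predU1P[->|eA] [->|->]; rewrite ?eqxx.
  - by constructor 1.
  - by constructor 2.
  - by constructor 3; exact: endpoint1.
  - by constructor 3; exact: endpoint2.
case=> [/eqP->|/eqP->|/mem_endpoints[e eA xe]].
- by exists f; rewrite ?inE ?eqxx //; left.
- by exists f; rewrite ?inE ?eqxx //; right.
- by exists e; rewrite ?inE ?eA ?orbT.
Qed.

Lemma uniq_endpoints_add alpha f : f.1 != f.2 ->
  f.1 \notin endpoints (arr alpha) -> f.2 \notin endpoints (arr alpha) ->
  uniq (endpoints (f |` arr alpha)%fset).
Proof.
move=> f12 f1 f2; have fA : f \notin arr alpha by apply: contra f1; exact: endpoint1.
by rewrite (perm_uniq (perm_endpoints_add fA)) /= inE negb_or f12 f1 f2 arr_uniq.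
Qed.

Definition add_arrow alpha f (f12 : f.1 != f.2)
    (f1 : f.1 \notin endpoints (arr alpha))
    (f2 : f.2 \notin endpoints (arr alpha)) : vstring T :=
  VString (uniq_endpoints_add f12 f1 f2).

Lemma in_restrict alpha D e :
  (e \in arr (restrict alpha D)) = [&& e \in arr alpha, e.1 \in D & e.2 \in D].
Proof. by rewrite !inE. Qed.

Lemma endpoints_restrict alpha D x : x \in endpoints (arr (restrict alpha D)) ->
  x \in endpoints (arr alpha) /\ x \in D.
Proof.
move=> /mem_endpoints[e]; rewrite in_restrict => /and3P[eA e1 e2].
by case=> ->; split=> //; [apply: endpoint1|apply: endpoint2].
Qed.

Lemma homotopic_refl alpha : homotopic alpha alpha.
Proof. exact: rst_refl. Qed.

Lemma homotopic_sym alpha beta : homotopic alpha beta -> homotopic beta alpha.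
Proof. exact: rst_sym. Qed.

Lemma homotopic_trans beta alpha gamma :
  homotopic alpha beta -> homotopic beta gamma -> homotopic alpha gamma.
Proof. exact: rst_trans. Qed.

Lemma homotopic_a alpha beta : move_a alpha beta -> homotopic alpha beta.
Proof. by move=> h; apply: rst_step; constructor 2. Qed.

Lemma homotopic_b alpha beta : move_b alpha beta -> homotopic alpha beta.
Proof. by move=> h; apply: rst_step; constructor 3. Qed.

Lemma homotopic_c alpha beta : move_c alpha beta -> homotopic alpha beta.
Proof. by move=> h; apply: rst_step; constructor 4. Qed.

Lemma homotopic_eq alpha beta : arr alpha = arr beta -> homotopic alpha beta.
Proof. by move=> /vstring_eq->; exact: homotopic_refl. Qed.

Lemma free_arcP alpha (I : {pred circle T}) :
  free_arc alpha I <-> forall x, x \in I -> x \notin endpoints (arr alpha).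
Proof.
split=> [h x xI|h x xA]; last by apply/negP => /h; rewrite xA.
by apply/negP => /h; rewrite xI.
Qed.

(** Move (a) adds an arrow whose forward arc is free; the arrow with a free
    backward arc is obtained by adding the antiparallel pair
    (c, d), (b, a) with c, d between a and b by move (b), and removing (c, d) by
    an inverse move (a). *)
Lemma homotopic_a_rev alpha beta a b : a != b -> free_arc alpha (arc a b) ->
  arr beta = ((b, a) |` arr alpha)%fset -> homotopic alpha beta.
Proof.
move=> ab /free_arcP fr bE.
have [c acb] := ccw_between ab; have [ac cb _] := ccw_neq acb.
have [d cdb] := ccw_between cb; have [cd db _] := ccw_neq cdb.
have [s1 s2 n1 n2] := arc_sub acb; have [s3 s4 n3 n4] := arc_sub cdb.
have nb x : x \in arc c d -> x \notin endpoints (arr beta).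
  move=> xI; rewrite bE mem_endpoints_add /= !negb_or fr ?andbT; last exact/s2/s3.
  apply/andP; split; first by apply: contraNneq n3 => <-.
  by apply: contraNneq n2 => <-; apply: s3.
have hc : c \notin endpoints (arr beta) by apply: nb; rewrite arcE eqxx.
have hd : d \notin endpoints (arr beta) by apply: nb; rewrite arcE eqxx orbT.
pose gamma := @add_arrow beta (c, d) cd hc hd.
apply: (homotopic_trans (beta := gamma)).
  apply: homotopic_b; exists a, c, d, b, c, a, d, b; split => //.
  - exact: disjoint_subarcs.
  - split; apply/free_arcP => x xI; apply: fr; first exact: s1.
    exact/s2/s4.
  - by split; [right|left].
  - by rewrite /= bE.
by apply/homotopic_sym/homotopic_a; exists c, d; split => //; apply/free_arcP.
Qed.

(** An arrow may slide along two free arcs. A homeomorphism would do, but two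
    moves suffice: pick x and y inside the arcs; the arrow (y, x) cancels
    against either (a1, b) or (a, b1) by an inverse move (b), so that both
    strings are homotopic to the one carrying all three arrows. *)
Lemma slide_arrow alpha beta (A : {fset arrow T}) a a1 b b1 :
  a != a1 -> b != b1 ->
  disjoint_preds (arc a a1) (arc b b1) ->
  (forall x, x \in endpoints A -> x \notin arc a a1 /\ x \notin arc b b1) ->
  arr alpha = ((a1, b) |` A)%fset -> arr beta = ((a, b1) |` A)%fset ->
  homotopic alpha beta.
Proof.
move=> aa1 bb1 dis fr aE bE.
have [x hx] := ccw_between aa1; have [ax xa1 _] := ccw_neq hx.
have [y hy] := ccw_between bb1; have [by_ yb1 _] := ccw_neq hy.
have [s1 s2 n1 n2] := arc_sub hx; have [s3 s4 n3 n4] := arc_sub hy.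
have dis' u v : u \in arc a a1 -> v \in arc b b1 -> u != v.
  by move=> /dis ub vb; apply: contraTneq vb => <-.
have aI : a \in arc a a1 by rewrite arcE eqxx.
have a1I : a1 \in arc a a1 by rewrite arcE eqxx orbT.
have bI : b \in arc b b1 by rewrite arcE eqxx.
have b1I : b1 \in arc b b1 by rewrite arcE eqxx orbT.
have xI : x \in arc a a1 by rewrite arcE hx !orbT.
have yI : y \in arc b b1 by rewrite arcE hy !orbT.
have nA1 u : u \in arc a a1 -> u \notin endpoints A.
  by move=> uI; apply/negP => /fr[]; rewrite uI.
have nA2 u : u \in arc b b1 -> u \notin endpoints A.
  by move=> uI; apply/negP => /fr[_]; rewrite uI.
have yx : y != x by rewrite eq_sym dis'.
have y1 : y \notin endpoints (arr alpha).
  by rewrite aE mem_endpoints_add /= !negb_or nA2 // andbT 1?eq_sym dis' //= eq_sym.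
have x1 : x \notin endpoints (arr alpha).
  by rewrite aE mem_endpoints_add /= !negb_or nA1 // xa1 dis'.
pose alpha' := @add_arrow alpha (y, x) yx y1 x1.
have a2 : a \notin endpoints (arr alpha').
  by rewrite /= aE !mem_endpoints_add /= !negb_or nA1 // ax aa1 !dis'.
have b2 : b1 \notin endpoints (arr alpha').
  rewrite /= aE !mem_endpoints_add /= !negb_or nA2 // andbT.
  by rewrite [b1 == y]eq_sym yb1 ![b1 == _]eq_sym bb1 !dis'.
pose gamma := @add_arrow alpha' (a, b1) (dis' _ _ aI b1I) a2 b2.
apply: (homotopic_trans (beta := gamma)).
  apply: homotopic_b; exists a, x, y, b1, a, x, b1, y; split => //.
  - move=> u /s1 ua; apply/negP => /s4 ub; by have := dis' _ _ ua ub; rewrite eqxx.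
  - split; apply/free_arcP => u ui; rewrite aE mem_endpoints_add /= !negb_or.
      rewrite nA1 ?(dis' u b) ?s1 // !andbT.
      by apply: contraNneq n1 => <-.
    rewrite nA2 ?s4 // [u == a1]eq_sym (dis' a1 u) ?s4 //= andbT.
    by apply: contraNneq n4 => <-.
  - by split; [left|right].
apply/homotopic_sym/homotopic_b; exists x, a1, b, y, a1, x, b, y; split => //.
- move=> u /s2 ua; apply/negP => /s3 ub; by have := dis' _ _ ua ub; rewrite eqxx.
- split; apply/free_arcP => u ui; rewrite bE mem_endpoints_add /= !negb_or.
    rewrite nA1 ?(dis' u b1) ?s2 // !andbT.
    by apply: contraNneq n2 => <-.
  rewrite nA2 ?s3 // [u == a]eq_sym (dis' a u) ?s3 //= andbT.
  by apply: contraNneq n3 => <-.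
- by split; [right|left].
- rewrite bE -[arr gamma]/((a, b1) |` ((y, x) |` arr alpha))%fset aE.
  by rewrite fsetUCA [X in (_ `|` X)%fset]fsetUCA fsetUCA.
Qed.

End VStrings.

(** * Sliding points inside an arc *)

Section Sliding.
Variable T : realType.
Implicit Types (p x y z a b c u v : circle T) (D : {pred circle T}).

Lemma ccw_asym x y z : ccw x y z -> ccw x z y = false.
Proof.
rewrite !(ccw_cut x) /cyc => h; apply/negbTE; move: h.
by move: (cut _ _) (cut _ _) (cut _ _) => *; lra.
Qed.

Lemma ccw_total x y z : x != y -> y != z -> x != z -> ccw x z y = ~~ ccw x y z.
Proof.
rewrite !(cut_eq x) !(ccw_cut x) /cyc.
by move: (cut _ _) (cut _ _) (cut _ _) => *; lra.
Qed.

Lemma ccwxx x y :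
  (ccw x x y = false) * (ccw x y y = false) * (ccw x y x = false).
Proof. by have [-> -> ->] := ccw_same x y. Qed.

(** Stated as a table of values, so that one hypothesis decides all six
    orderings of its three points when rewriting. *)
Lemma ccwE x y z : ccw x y z ->
  (ccw x y z = true) * (ccw y z x = true) * (ccw z x y = true) *
  (ccw x z y = false) * (ccw z y x = false) * (ccw y x z = false).
Proof.
move=> h; have h' := ccw_asym h.
have [e1 e2] : ccw y z x = true /\ ccw z x y = true by rewrite -ccw_rot (ccw_rot z).
have [e3 e4] : ccw z y x = false /\ ccw y x z = false by rewrite -ccw_rot (ccw_rot y).
by rewrite h e1 e2 h' e3 e4.
Qed.

Lemma ccw_out a b x : a != b -> x \notin arc a b -> ccw a b x.
Proof.
move=> ab; rewrite arcE !negb_or => /and3P[xa xb h].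
by rewrite ccw_total // eq_sym.
Qed.

Lemma disjoint_preds_sym (I J : {pred circle T}) :
  disjoint_preds I J -> disjoint_preds J I.
Proof. by move=> dis x xJ; apply/negP => /dis; rewrite xJ. Qed.

(** The compatibility that makes a move along the arc I restrict to the arrows
    inside D: the arc lies entirely in D or entirely outside. *)
Definition same_on D (I : {pred circle T}) :=
  forall x y, x \in I -> y \in I -> (x \in D) = (y \in D).

Lemma open_arc_same u v p q : p != q -> u \notin arc p q -> v \notin arc p q ->
  same_on (open_arc u v) (arc p q).
Proof. by move=> pq uI vI x y xI yI; exact: (arc_side pq). Qed.

(** Points a and a' of one arc, and b and b' of a disjoint one, cut the circle
    in the same way as far as points outside both arcs are concerned. *)
Lemma ccw_slide p q r s a a' b b' x : p != q -> r != s ->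
  disjoint_preds (arc p q) (arc r s) ->
  a \in arc p q -> a' \in arc p q -> b \in arc r s -> b' \in arc r s ->
  x \notin arc p q -> x \notin arc r s -> ccw a x b = ccw a' x b'.
Proof.
move=> pq rs dis aI a'I bJ b'J xI xJ.
have bI := disjoint_preds_sym dis bJ; have a'J := dis _ a'I.
rewrite -[LHS]ccw_rot (arc_side pq bI xI aI a'I) ccw_rot.
by rewrite ccw_rot (arc_side rs xJ a'J bJ b'J) -ccw_rot.
Qed.

Lemma ccw_disjoint_arcs p q r s : p != q -> r != s ->
  disjoint_preds (arc p q) (arc r s) ->
  [/\ ccw p q r, ccw p q s, ccw p r s & ccw q r s].
Proof.
move=> pq rs dis; have dis' := disjoint_preds_sym dis.
split; try by apply: ccw_out => //; apply: dis'; rewrite arcE eqxx ?orbT.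
- by rewrite ccw_rot; apply: ccw_out => //; apply: dis; rewrite arcE eqxx.
- by rewrite ccw_rot; apply: ccw_out => //; apply: dis; rewrite arcE eqxx orbT.
Qed.

(** Arrows inside the open arc a b leave the complementary closed arc free. *)
Lemma open_arc_compl a b x : x \in open_arc a b -> x \notin arc b a.
Proof.
rewrite inE => h; have [ax xb _] := ccw_neq h.
by rewrite arcE !negb_or xb eq_sym ax /= -ccw_rot ccw_asym.
Qed.

End Sliding.

(** * Restricting moves (a) and (b) to the arrows inside a set *)

Section Restriction.
Variable T : realType.
Implicit Types (alpha beta : vstring T) (e f g : arrow T) (A : {fset arrow T}).
Implicit Types (a b x y : circle T) (D : {pred circle T}).

Definition inside D e := (e.1 \in D) && (e.2 \in D).

Definition filter_inside A D := [fset e in A | inside D e]%fset.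

Lemma arr_restrict alpha D : arr (restrict alpha D) = filter_inside (arr alpha) D.
Proof. by []. Qed.

Lemma filter_insideU1 A D f : filter_inside (f |` A)%fset D =
  (if inside D f then f |` filter_inside A D else filter_inside A D)%fset.
Proof.
apply/fsetP => e; case: ifP => Df; rewrite !inE /=.
  by case: eqP => [->|]; rewrite ?Df.
by case: eqP => [->|] //=; rewrite Df andbF.
Qed.

Lemma eq_filter_inside A D D' :
  (forall x, x \in endpoints A -> (x \in D) = (x \in D')) ->
  filter_inside A D = filter_inside A D'.
Proof.
move=> DD; apply/fsetP => e; rewrite !inE /= /inside; case eA: (e \in A) => //=.
by rewrite !DD // ?endpoint1 ?endpoint2.
Qed.

Lemma endpoints_filter A D x : x \in endpoints (filter_inside A D) ->
  x \in endpoints A /\ x \in D.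
Proof.
move=> /mem_endpoints[e]; rewrite !inE /= => /and3P[eA e1 e2].
by case=> ->; split=> //; [apply: endpoint1|apply: endpoint2].
Qed.

Lemma free_restrict alpha D (I : {pred circle T}) :
  free_arc alpha I -> free_arc (restrict alpha D) I.
Proof. by move=> h x /endpoints_restrict[/h]. Qed.

Lemma restrict_a alpha beta a b D : a != b -> free_arc alpha (arc a b) ->
  arr beta = ((a, b) |` arr alpha)%fset -> same_on D (arc a b) ->
  homotopic (restrict alpha D) (restrict beta D).
Proof.
move=> ab fr bE same; have [Df|Df] := boolP (inside D (a, b)).
  apply: homotopic_a; exists a, b; split => //; first exact: free_restrict.
  by rewrite !arr_restrict bE filter_insideU1 Df.
by apply: homotopic_eq; rewrite !arr_restrict bE filter_insideU1 (negPf Df).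
Qed.

(** The two new arrows have their endpoints in the same two arcs, so both or
    none of them lie inside D. *)
Lemma restrict_b alpha beta p q r s a a' b b' D :
  p != q -> r != s -> disjoint_preds (arc p q) (arc r s) ->
  free_arc alpha (arc p q) -> free_arc alpha (arc r s) ->
  (a, a') = (p, q) \/ (a, a') = (q, p) ->
  (b, b') = (r, s) \/ (b, b') = (s, r) ->
  arr beta = ((a, b) |` ((b', a') |` arr alpha))%fset ->
  same_on D (arc p q) -> same_on D (arc r s) ->
  homotopic (restrict alpha D) (restrict beta D).
Proof.
move=> pq rs dis fI fJ aE bE betaE sI sJ.
have pqD : (p \in D) = (q \in D) by apply: sI; rewrite arcE eqxx ?orbT.
have rsD : (r \in D) = (s \in D) by apply: sJ; rewrite arcE eqxx ?orbT.
have same : inside D (b', a') = inside D (a, b).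
  by case: aE => -[-> ->]; case: bE => -[-> ->]; rewrite /inside /= ?pqD ?rsD andbC.
have [Df|Df] := boolP (inside D (a, b)).
  apply: homotopic_b; exists p, q, r, s, a, a', b, b'; split => //.
    by split; exact: free_restrict.
  by rewrite !arr_restrict betaE !filter_insideU1 same Df.
by apply: homotopic_eq; rewrite !arr_restrict betaE !filter_insideU1 same (negPf Df).
Qed.

(** The two loops differ by a sliver along the two arcs of the move, which no
    arrow of alpha meets, so they carry the same arrows of alpha. One of them may
    also carry the other new arrow; one of the arcs cut off by this arrow is then
    free in the loop, so that it is removed by move (a) or its reverse. By symmetry
    the second loop of (a, b) and the first loop of (b', a') are homotopic too, and
    the two new terms of the cobracket cancel. *)
Lemma move_b_loops alpha beta p q r s a a' b b' :
  p != q -> r != s -> disjoint_preds (arc p q) (arc r s) ->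
  free_arc alpha (arc p q) -> free_arc alpha (arc r s) ->
  (a, a') = (p, q) \/ (a, a') = (q, p) ->
  (b, b') = (r, s) \/ (b, b') = (s, r) ->
  arr beta = ((a, b) |` ((b', a') |` arr alpha))%fset ->
  homotopic (string1 beta (a, b)) (string2 beta (b', a')).
Proof.
move=> pq rs dis /free_arcP fI /free_arcP fJ aE bE betaE.
have [pqr pqs prs qrs] := ccw_disjoint_arcs pq rs dis.
rewrite /string1 /string2 /=.
have common : filter_inside (arr alpha) (open_arc a b)
            = filter_inside (arr alpha) (open_arc a' b').
  apply: eq_filter_inside => x xA; rewrite !inE; apply: (ccw_slide pq rs dis).
  - by case: aE => -[-> _]; rewrite arcE eqxx ?orbT.
  - by case: aE => -[_ ->]; rewrite arcE eqxx ?orbT.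
  - by case: bE => -[-> _]; rewrite arcE eqxx ?orbT.
  - by case: bE => -[_ ->]; rewrite arcE eqxx ?orbT.
  - by apply/negP => /fI; rewrite xA.
  - by apply/negP => /fJ; rewrite xA.
have tbl := (@ccwxx T, ccwE pqr, ccwE pqs, ccwE prs, ccwE qrs).
have [_ qr _] := ccw_neq pqr; have rq : r != q by rewrite eq_sym.
have free gamma : arr gamma = filter_inside (arr alpha) (open_arc q r) ->
    free_arc gamma (arc r q).
  by move=> gE x; rewrite gE => /endpoints_filter[_]; exact: open_arc_compl.
(* The new arrows cross in the first and in the last case. *)
case: aE => -[? ?]; case: bE => -[? ?]; subst a a' b b'.
- by apply: homotopic_eq; rewrite !arr_restrict betaE !filter_insideU1 /inside /= !inE !tbl.
- have base : arr (restrict beta (open_arc q r)) = filter_inside (arr alpha) (open_arc q r).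
    by rewrite arr_restrict betaE !filter_insideU1 /inside /= !inE !tbl.
  apply/homotopic_sym/homotopic_a; exists r, q; split => //; first exact: free.
  by rewrite base arr_restrict betaE !filter_insideU1 /inside /= !inE !tbl common.
- have base : arr (restrict beta (open_arc q r)) = filter_inside (arr alpha) (open_arc q r).
    by rewrite arr_restrict betaE !filter_insideU1 /inside /= !inE !tbl.
  apply: (homotopic_a_rev rq); first exact: free.
  by rewrite base arr_restrict betaE !filter_insideU1 /inside /= !inE !tbl common.
- by apply: homotopic_eq; rewrite !arr_restrict betaE !filter_insideU1 /inside /= !inE !tbl.
Qed.

End Restriction.

(** * Move (c) and its effect on the loops of the three arrows *)

Lemma fset1U_rot (K : choiceType) (x y z : K) (A : {fset K}) :
  (x |` (y |` (z |` A)))%fset = (y |` (z |` (x |` A)))%fset.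
Proof. by rewrite fsetUCA (fsetUCA [fset x]%fset [fset z]%fset). Qed.

Lemma in_fset3 (K : choiceType) (x y z e : K) :
  (e \in [fset x; y; z]%fset) = [|| e == x, e == y | e == z].
Proof. by rewrite !inE orbA. Qed.

Lemma in_fset1U3 (K : choiceType) (x y z e : K) (A : {fset K}) :
  (e \in (x |` (y |` (z |` A)))%fset) = [|| e == x, e == y, e == z | e \in A].
Proof. by rewrite !inE. Qed.

Lemma fset1U3_mem (K : choiceType) (x y z : K) (A : {fset K})
    (B := (x |` (y |` (z |` A)))%fset) :
  [/\ x \in B, y \in B & z \in B].
Proof. by rewrite !in_fset1U3 !eqxx !orbT. Qed.

Lemma fset1U3_split (K : choiceType) (x y z : K) (B : {fset K}) :
  x \in B -> y \in B -> z \in B ->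
  B = (x |` (y |` (z |` (B `\` [fset x; y; z]))))%fset.
Proof.
move=> xB yB zB; apply/fsetP => e; rewrite !inE.
by case: eqP => [->|_] //=; case: eqP => [->|_] //=; case: eqP => [->|_] //=.
Qed.

Lemma fset1U3E (K : choiceType) (x y z : K) (A : {fset K}) :
  (x |` (y |` (z |` A)))%fset = (A `|` [fset x; y; z])%fset.
Proof. by rewrite [RHS]fsetUC !fsetUA. Qed.

Lemma fset1U3_replace (K : choiceType) (x y z x' y' z' : K) (A : {fset K}) :
  x \notin A -> y \notin A -> z \notin A ->
  (x' |` (y' |` (z' |` A)) =
    ((x |` (y |` (z |` A))) `\` [fset x; y; z]) `|` [fset x'; y'; z'])%fset.
Proof.
move=> xA yA zA; rewrite fset1U3E; congr (_ `|` _)%fset; apply/fsetP => e.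
rewrite !inE; have [eA|_] := boolP (e \in A); rewrite ?orbT ?orbF ?andbT.
  rewrite -!orbA !negb_or; apply/esym/and3P.
  by split; [apply: contraNneq xA|apply: contraNneq yA|apply: contraNneq zA] => <-.
by rewrite -orbA andNb.
Qed.

Section Triangle.
Variable T : realType.
Implicit Types (alpha beta : vstring T) (C : {fset arrow T}).
Implicit Types (a b c x y : circle T) (D : {pred circle T}).

(** The configuration of move (c): C is the set of arrows not moved, and a1,
    b1, c1 are the positive ends of the three arcs. *)
Record triangle C a a1 b b1 c c1 : Prop := Triangle {
  triangle_neq : [/\ a != a1, b != b1 & c != c1];
  triangle_disjoint : [/\ disjoint_preds (arc a a1) (arc b b1),
    disjoint_preds (arc b b1) (arc c c1) & disjoint_preds (arc c c1) (arc a a1)];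
  triangle_free : forall x, x \in endpoints C ->
    [/\ x \notin arc a a1, x \notin arc b b1 & x \notin arc c c1] }.

Definition triangle_before C a a1 b b1 c c1 : {fset arrow T} :=
  ((a1, b) |` ((b1, c) |` ((c1, a) |` C)))%fset.

Lemma triangle_rot C a a1 b b1 c c1 :
  triangle C a a1 b b1 c c1 -> triangle C b b1 c c1 a a1.
Proof. by case=> -[? ? ?] [? ? ?] fr; split => // x /fr[]. Qed.

Lemma triangle_before_rot C a a1 b b1 c c1 :
  triangle_before C a a1 b b1 c c1 = triangle_before C b b1 c c1 a a1.
Proof. exact: fset1U_rot. Qed.

Definition triangle_after C a a1 b b1 c c1 : {fset arrow T} :=
  ((a, b1) |` ((b, c1) |` ((c, a1) |` C)))%fset.

Lemma triangle_after_rot C a a1 b b1 c c1 :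
  triangle_after C a a1 b b1 c c1 = triangle_after C b b1 c c1 a a1.
Proof. exact: fset1U_rot. Qed.

Lemma move_c_triangle alpha beta : move_c alpha beta ->
  exists C a a1 b b1 c c1, [/\ triangle C a a1 b b1 c c1,
    arr alpha = triangle_before C a a1 b b1 c c1
  & arr beta = triangle_after C a a1 b b1 c c1].
Proof.
move=> [a [a1 [b [b1 [c [c1 [[e1 e2 e3] [d1 d2 d3] fr bE]]]]]]].
have n1 := arr_neq e1; have n2 := arr_neq e2; have n3 := arr_neq e3.
have sh e f x eA fA xe xf := @arr_share T alpha e f x eA fA xe xf.
have aa1 : a != a1.
  apply/eqP => e; have [e4 _] : (a1, b) = (c1, a).
    by apply: (sh _ _ a1 e1 e3); rewrite !inE ?e eqxx ?orbT.
  by move: n3; rewrite /= -e4 e eqxx.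
have bb1 : b != b1.
  apply/eqP => e; have [e4 _] : (b1, c) = (a1, b).
    by apply: (sh _ _ b1 e2 e1); rewrite !inE ?e eqxx ?orbT.
  by move: n1; rewrite /= -e4 e eqxx.
have cc1 : c != c1.
  apply/eqP => e; have [e4 _] : (c1, a) = (b1, c).
    by apply: (sh _ _ c1 e3 e2); rewrite !inE ?e eqxx ?orbT.
  by move: n2; rewrite /= -e4 e eqxx.
exists (arr alpha `\` [fset (a1, b); (b1, c); (c1, a)])%fset,
  a, a1, b, b1, c, c1; split.
- split=> // x /mem_endpoints[e]; rewrite in_fsetD => /andP[eS eA] xe.
  have xe' : x \in [:: e.1; e.2] by rewrite !inE; case: xe => ->; rewrite eqxx ?orbT.
  apply: fr; first by apply/mem_endpoints; exists e.
  apply: contra eS; rewrite in_fset3 !inE.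
  move=> /or4P[||| /or3P[||]] /eqP xx; rewrite xx in xe'.
  + by rewrite (sh _ _ a eA e3 xe') ?inE ?eqxx ?orbT.
  + by rewrite (sh _ _ a1 eA e1 xe') ?inE ?eqxx ?orbT.
  + by rewrite (sh _ _ b eA e1 xe') ?inE ?eqxx ?orbT.
  + by rewrite (sh _ _ b1 eA e2 xe') ?inE ?eqxx ?orbT.
  + by rewrite (sh _ _ c eA e2 xe') ?inE ?eqxx ?orbT.
  + by rewrite (sh _ _ c1 eA e3 xe') ?inE ?eqxx ?orbT.
- exact: fset1U3_split.
- by rewrite bE /triangle_after fset1U3E.
Qed.

(** If D contains the three arcs then the move itself restricts; if D contains
    two of them then exactly one of the three arrows lies inside D before and
    after the move, and it slides along two arcs; otherwise nothing changes. *)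
Lemma restrict_c alpha beta C a a1 b b1 c c1 D : triangle C a a1 b b1 c c1 ->
  arr alpha = triangle_before C a a1 b b1 c c1 ->
  arr beta = triangle_after C a a1 b b1 c c1 ->
  same_on D (arc a a1) -> same_on D (arc b b1) -> same_on D (arc c c1) ->
  homotopic (restrict alpha D) (restrict beta D).
Proof.
move=> tri aE bE sa sb sc; have [[aa1 bb1 cc1] [dab dbc dca] fr] := tri.
have a1D : (a1 \in D) = (a \in D) by apply: sa; rewrite arcE eqxx ?orbT.
have b1D : (b1 \in D) = (b \in D) by apply: sb; rewrite arcE eqxx ?orbT.
have c1D : (c1 \in D) = (c \in D) by apply: sc; rewrite arcE eqxx ?orbT.
have frD x : x \in endpoints (filter_inside C D) ->
    [/\ x \notin arc a a1, x \notin arc b b1 & x \notin arc c c1].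
  by move=> /endpoints_filter[/fr].
have aE' := congr1 (fun A => filter_inside A D) aE.
rewrite /triangle_before !filter_insideU1 /inside /= a1D b1D c1D in aE'.
have bE' := congr1 (fun A => filter_inside A D) bE.
rewrite /triangle_after !filter_insideU1 /inside /= a1D b1D c1D in bE'.
move: aE' bE'.
case: (a \in D); case: (b \in D); case: (c \in D) => /= aE' bE';
  rewrite -arr_restrict in aE'; rewrite -arr_restrict in bE'.
- apply: homotopic_c; exists a, a1, b, b1, c, c1; split; [|by []| |].
  + by rewrite aE'; exact: fset1U3_mem.
  + move=> p pe np; apply: frD; move: np pe; rewrite aE' !mem_endpoints_add /=.
    rewrite !inE !negb_or => /andP[/negPf-> /andP[/negPf-> /andP[/negPf->]]].
    by move=> /and3P[/negPf-> /negPf-> /negPf->].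
  + have notC x y : x \in [:: a1; b1; c1] -> (x, y) \notin filter_inside C D.
      move=> xI; apply/negP => /endpoint1/frD[]; move: xI; rewrite /= !inE.
      by case/or3P => /eqP->; rewrite eqxx ?orbT.
    by rewrite aE' bE'; apply: fset1U3_replace; apply: notC; rewrite !inE eqxx ?orbT.
- by apply: (slide_arrow aa1 bb1 dab _ aE' bE') => x /frD[].
- by apply: (slide_arrow cc1 aa1 dca _ aE' bE') => x /frD[].
- exact: homotopic_eq (etrans aE' (esym bE')).
- by apply: (slide_arrow bb1 cc1 dbc _ aE' bE') => x /frD[].
- exact: homotopic_eq (etrans aE' (esym bE')).
- exact: homotopic_eq (etrans aE' (esym bE')).
- exact: homotopic_eq (etrans aE' (esym bE')).
Qed.

(** The loops of (a1, b) in alpha and of (a, b1) in beta carry the same unmoved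
    arrows. Among the two other arrows of the triangle, all endpoints of which
    lie near the ends of the loop or in the arc c c1, the first loop carries
    none in alpha, and both or none in beta according to whether c lies between
    a and b; the second loop carries none in beta, and both or none in alpha in
    the opposite cases. When both are present they form a pair removable by an
    inverse move (b), because the arc closing the loop is free. *)
Lemma move_c_loops alpha beta C a a1 b b1 c c1 : triangle C a a1 b b1 c c1 ->
  arr alpha = triangle_before C a a1 b b1 c c1 ->
  arr beta = triangle_after C a a1 b b1 c c1 ->
  homotopic (string1 alpha (a1, b)) (string1 beta (a, b1)) /\
  homotopic (string2 alpha (a1, b)) (string2 beta (a, b1)).
Proof.
move=> tri aE bE; have [[aa1 bb1 cc1] [dab dbc dca] fr] := tri.
have [h1 h2 h3 h4] := ccw_disjoint_arcs aa1 bb1 dab.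
have [h5 h6 h7 h8] := ccw_disjoint_arcs bb1 cc1 dbc.
have [h9 h10 h11 h12] := ccw_disjoint_arcs cc1 aa1 dca.
pose tbl := (@ccwxx T, (ccwE h1, ccwE h2, ccwE h3, ccwE h4),
  (ccwE h5, ccwE h6, ccwE h7, ccwE h8), (ccwE h9, ccwE h10, ccwE h11, ccwE h12)).
have aI : a \in arc a a1 by rewrite arcE eqxx.
have a1I : a1 \in arc a a1 by rewrite arcE eqxx orbT.
have bI : b \in arc b b1 by rewrite arcE eqxx.
have b1I : b1 \in arc b b1 by rewrite arcE eqxx orbT.
have cI : c \in arc c c1 by rewrite arcE eqxx.
have c1I : c1 \in arc c c1 by rewrite arcE eqxx orbT.
have slide x y u v z : x \in arc a a1 -> y \in arc a a1 -> u \in arc b b1 ->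
    v \in arc b b1 -> z \notin arc a a1 -> z \notin arc b b1 ->
    ccw x z u = ccw y z v by exact: (ccw_slide aa1 bb1 dab).
have dac := disjoint_preds_sym dca.
have dcb := disjoint_preds_sym dbc.
have slide' x y u v z : x \in arc a a1 -> y \in arc a a1 -> u \in arc b b1 ->
    v \in arc b b1 -> z \notin arc a a1 -> z \notin arc b b1 ->
    ccw u z x = ccw v z y.
  move=> *; exact: (ccw_slide bb1 aa1 (disjoint_preds_sym dab)).
have common1 : filter_inside C (open_arc a1 b) = filter_inside C (open_arc a b1).
  by apply: eq_filter_inside => x /fr[xa xb _]; exact: slide.
have common2 : filter_inside C (open_arc b a1) = filter_inside C (open_arc b1 a).
  by apply: eq_filter_inside => x /fr[xa xb _]; exact: slide'.
have o1 z : z \in arc c c1 -> ccw a z b1 = ccw a c b.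
  move=> zI; rewrite (@slide a a b1 b) ?dca ?dcb //.
  by rewrite (arc_side cc1 (dac _ aI) (dbc _ bI) zI cI).
have o2 z : z \in arc c c1 -> ccw b z a1 = ccw b c a.
  move=> zI; rewrite (@slide' a1 a b b) ?dca ?dcb //.
  by rewrite (arc_side cc1 (dbc _ bI) (dac _ aI) zI cI).
have ab : a != b by apply/eqP => e; have := dab _ aI; rewrite e bI.
have bc : b != c by apply/eqP => e; have := dbc _ bI; rewrite e cI.
have ac : a != c by apply/eqP => e; have := dac _ aI; rewrite e cI.
have oE : ccw b c a = ~~ ccw a c b.
  by rewrite -ccw_rot (ccw_total ab bc ac) negbK.
split.
- have aE' := congr1 (fun A => filter_inside A (open_arc a1 b)) aE.
  rewrite /triangle_before !filter_insideU1 /inside /= !inE !tbl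
    ?andbF ?andbT /= common1 in aE'.
  have bE' := congr1 (fun A => filter_inside A (open_arc a b1)) bE.
  rewrite /triangle_after !filter_insideU1 /inside /= !inE !tbl
    ?andbF ?andbT /= (o1 _ cI) (o1 _ c1I) in bE'.
  case: (boolP (ccw a c b)) => acb; rewrite ?acb ?(negPf acb) /= in bE';
    last by apply: homotopic_eq; exact: (etrans aE' (esym bE')).
  apply: homotopic_b; exists b, a1, c, c1, b, a1, c1, c; split.
  + by split=> //; apply/eqP => e; have := dab _ a1I; rewrite -e bI.
  + move=> u uI; apply/negP => uJ; move: uI; rewrite arcE (o2 _ uJ) oE acb orbF.
    by case/orP => /eqP e; [have := dcb _ uJ|have := dca _ uJ]; rewrite e ?bI ?a1I.
  + have aE1 := etrans aE' (esym common1).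
    split=> x; first by rewrite [arr _]aE1 => /endpoints_filter[_]; exact: open_arc_compl.
    by rewrite [arr _]aE1 => /endpoints_filter[/fr[]].
  + by split; [left|right].
  + exact: (etrans bE' (congr1 (fun A => (b, c1) |` ((c, a1) |` A))%fset (esym aE'))).
- have bE' := congr1 (fun A => filter_inside A (open_arc b1 a)) bE.
  rewrite /triangle_after !filter_insideU1 /inside /= !inE !tbl
    ?andbF ?andbT /= -common2 in bE'.
  have aE' := congr1 (fun A => filter_inside A (open_arc b a1)) aE.
  rewrite /triangle_before !filter_insideU1 /inside /= !inE !tbl
    ?andbF ?andbT /= (o2 _ cI) (o2 _ c1I) in aE'.
  case: (boolP (ccw b c a)) => bca; rewrite ?bca ?(negPf bca) /= in aE';
    last by apply: homotopic_eq; exact: (etrans aE' (esym bE')).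
  apply/homotopic_sym/homotopic_b; exists a, b1, c, c1, b1, a, c, c1; split.
  + by split=> //; apply/eqP => e; have := dab _ aI; rewrite e b1I.
  + move=> u uI; apply/negP => uJ; move: uI; rewrite arcE (o1 _ uJ).
    move: bca; rewrite oE => /negPf->; rewrite orbF.
    by case/orP => /eqP e; [have := dca _ uJ|have := dcb _ uJ]; rewrite e ?aI ?b1I.
  + have bE1 := etrans bE' common2.
    split=> x; first by rewrite [arr _]bE1 => /endpoints_filter[_]; exact: open_arc_compl.
    by rewrite [arr _]bE1 => /endpoints_filter[/fr[]].
  + by split; [right|left].
  + exact: (etrans aE' (congr1 (fun A => (b1, c) |` ((c1, a) |` A))%fset (esym bE'))).
Qed.

End Triangle.

(** * Invariance of the sum under the moves *)

Section Tens.
Variables (R : comPzRingType) (A B : lmodType R).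

Lemma tens0l (b : B) : (0 : A) ⊗ b = 0.
Proof.
have [/(_ b) l _] := tens_bilinear A B.
(* Linearity at -1 times 0 plus 0. *)
by rewrite -[X in X ⊗ _](scaler0 _ (-1)) -[X in X ⊗ _]addr0
  l scaleN1r addNr.
Qed.

Lemma tens0r (a : A) : a ⊗ (0 : B) = 0.
Proof.
have [_ /(_ a) r] := tens_bilinear A B.
by rewrite -[X in _ ⊗ X](scaler0 _ (-1)) -[X in _ ⊗ X]addr0
  r scaleN1r addNr.
Qed.

End Tens.

Section Invariance.
Variables (T : realType) (R : comPzRingType).
Implicit Types (alpha beta : vstring T) (e f : arrow T).
Local Notation gen := (string_gen R).
Local Notation A0 := (A0 T R).

Definition wedge (x y : A0) : tensor A0 A0 := x ⊗ y - y ⊗ x.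

Lemma wedge0l y : wedge 0 y = 0.
Proof. by rewrite /wedge tens0l tens0r subrr. Qed.

Lemma wedgeC x y : wedge y x = - wedge x y.
Proof. by rewrite /wedge opprB. Qed.

Definition loop_term alpha e := wedge (gen (string1 alpha e)) (gen (string2 alpha e)).

Lemma cobracket_sumE alpha :
  cobracket_sum R alpha = \sum_(e <- arr alpha) loop_term alpha e.
Proof. by []. Qed.

Lemma trivial_homotopic alpha beta : homotopic alpha beta ->
  homotopically_trivial alpha -> homotopically_trivial beta.
Proof.
move=> ab [g tg ag]; exists g => //.
exact: homotopic_trans (homotopic_sym ab) ag.
Qed.

Lemma gen_homotopic alpha beta : homotopic alpha beta -> gen alpha = gen beta.
Proof.
move=> ab; rewrite /string_gen.
case: pselect => ta; case: pselect => tb //.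
- by case: tb; exact: trivial_homotopic ta.
- by case: ta; exact: trivial_homotopic (homotopic_sym ab) tb.
congr free_gen; apply: val_inj; rewrite /= /homotopy_class.
apply/predeqP => g; split; first exact/homotopic_trans/homotopic_sym.
exact: homotopic_trans.
Qed.

Lemma gen_trivial alpha : arr alpha = fset0 -> gen alpha = 0.
Proof.
move=> a0; rewrite /string_gen; case: pselect => // -[].
by exists alpha => //; exact: homotopic_refl.
Qed.

Lemma loop_term_homotopic alpha beta e f :
  homotopic (string1 alpha e) (string1 beta f) ->
  homotopic (string2 alpha e) (string2 beta f) ->
  loop_term alpha e = loop_term beta f.
Proof. by move=> h1 h2; rewrite /loop_term (gen_homotopic h1) (gen_homotopic h2). Qed.

(** The arrows present before and after a move contribute the same terms as
    soon as the move restricts to the two loops of each of them. *)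
Lemma sum_restrict_homotopic alpha beta (C : {fset arrow T}) :
  (forall e D, e \in C -> D = open_arc e.1 e.2 \/ D = open_arc e.2 e.1 ->
    homotopic (restrict alpha D) (restrict beta D)) ->
  \sum_(e <- C) loop_term alpha e = \sum_(e <- C) loop_term beta e.
Proof.
move=> h; apply: eq_big_seq => e eC.
by apply: loop_term_homotopic; apply: (h e); rewrite //; [left|right].
Qed.

(** Reduces the compatibility of both loops of e with an arc of a move to the
    fact that the endpoints of e avoid this arc. *)
Lemma same_on_both e p q : p != q -> e.1 \notin arc p q -> e.2 \notin arc p q ->
  forall D, D = open_arc e.1 e.2 \/ D = open_arc e.2 e.1 -> same_on D (@arc T p q).
Proof. by move=> pq e1 e2 D [] ->; apply: open_arc_same. Qed.

(** The new arrow contributes zero because its first loop has no arrows. *)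
Lemma cobracket_a alpha beta : move_a alpha beta ->
  cobracket_sum R beta = cobracket_sum R alpha.
Proof.
move=> [a [b [ab fr bE]]]; have fr' := (free_arcP alpha (arc a b)).1 fr.
have nA : (a, b) \notin arr alpha.
  by apply: contraL (fr' a _) => [/endpoint1|]; rewrite ?arcE ?eqxx // negbK.
rewrite !cobracket_sumE {1}bE (big_fsetU1 _ _ nA) [LHS]/=.
have -> : loop_term beta (a, b) = 0.
  rewrite /loop_term gen_trivial ?wedge0l //.
  apply/fsetP => e; rewrite in_fset0; apply/negbTE/negP.
  move=> /endpoint1/endpoints_restrict[]; rewrite bE mem_endpoints_add /= !inE.
  case/or3P => [/eqP->|/eqP->|eA]; rewrite ?ccwxx // => abe.
  by move: (fr' e.1); rewrite arcE abe !orbT eA => /(_ isT).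
rewrite add0r; apply/esym/sum_restrict_homotopic => e D eA De.
apply: (restrict_a ab fr bE); apply: same_on_both De => //.
- by apply/negP => /fr'; rewrite endpoint1.
- by apply/negP => /fr'; rewrite endpoint2.
Qed.

Lemma cobracket_b alpha beta : move_b alpha beta ->
  cobracket_sum R beta = cobracket_sum R alpha.
Proof.
move=> [p [q [r [s [a [a' [b [b' [[pq rs] dis [fI fJ] [aE bE] betaE]]]]]]]]].
have fI' := (free_arcP _ _).1 fI; have fJ' := (free_arcP _ _).1 fJ.
have aI : a \in arc p q by case: aE => -[-> _]; rewrite arcE eqxx ?orbT.
have a'I : a' \in arc p q by case: aE => -[_ ->]; rewrite arcE eqxx ?orbT.
have b'J : b' \in arc r s by case: bE => -[_ ->]; rewrite arcE eqxx ?orbT.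
have bJ : b \in arc r s by case: bE => -[-> _]; rewrite arcE eqxx ?orbT.
have n2 : (b', a') \notin arr alpha.
  by apply/negP => /endpoint1 /=; apply/negP; exact: fJ'.
have n1 : (a, b) \notin ((b', a') |` arr alpha)%fset.
  rewrite in_fset1U negb_or; apply/andP; split.
    by apply/eqP => -[e _]; have := dis _ aI; rewrite e b'J.
  by apply/negP => /endpoint1 /=; apply/negP; exact: fI'.
rewrite !cobracket_sumE {1}betaE (big_fsetU1 _ _ n1) (big_fsetU1 _ _ n2) /= addrA.
have -> : loop_term beta (a, b) + loop_term beta (b', a') = 0.
  have h1 := move_b_loops pq rs dis fI fJ aE bE betaE.
  have h2 : homotopic (string1 beta (b', a')) (string2 beta (a, b)).
    apply: (move_b_loops rs pq (disjoint_preds_sym dis) fJ fI (a := b') (a' := b)).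
    - by case: bE => -[-> ->]; [right|left].
    - by case: aE => -[-> ->]; [right|left].
    - exact: (etrans betaE (fsetUCA _ _ _)).
  by rewrite /loop_term (gen_homotopic h1) (gen_homotopic h2) wedgeC addNr.
rewrite add0r; apply/esym/sum_restrict_homotopic => e D eA De.
have e1 := endpoint1 eA; have e2 := endpoint2 eA.
apply: (restrict_b pq rs dis fI fJ aE bE betaE); apply: same_on_both De => //.
- by apply/negP => /fI'; rewrite e1.
- by apply/negP => /fI'; rewrite e2.
- by apply/negP => /fJ'; rewrite e1.
- by apply/negP => /fJ'; rewrite e2.
Qed.

Lemma sum_fset1U3 (K : choiceType) (V : nmodType) (x y z : K) (C : {fset K})
    (F : K -> V) :
  x \notin C -> y \notin C -> z \notin C -> x != y -> y != z -> x != z ->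
  \sum_(e <- (x |` (y |` (z |` C)))%fset) F e = F x + (F y + (F z + \sum_(e <- C) F e)).
Proof.
move=> xC yC zC xy yz xz.
by rewrite !big_fsetU1 //= !inE !negb_or ?xy ?xz ?yz.
Qed.

Lemma cobracket_c alpha beta : move_c alpha beta ->
  cobracket_sum R beta = cobracket_sum R alpha.
Proof.
move=> /move_c_triangle[C [a [a1 [b [b1 [c [c1 [tri aE bE]]]]]]]].
have tri2 := triangle_rot tri; have tri3 := triangle_rot tri2.
have aE2 : arr alpha = triangle_before C b b1 c c1 a a1 by rewrite -triangle_before_rot.
have aE3 : arr alpha = triangle_before C c c1 a a1 b b1 by rewrite -triangle_before_rot.
have bE2 : arr beta = triangle_after C b b1 c c1 a a1 by rewrite -triangle_after_rot.
have bE3 : arr beta = triangle_after C c c1 a a1 b b1 by rewrite -triangle_after_rot.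
have [s1 s2] := move_c_loops tri aE bE.
have [s3 s4] := move_c_loops tri2 aE2 bE2.
have [s5 s6] := move_c_loops tri3 aE3 bE3.
have [[aa1 bb1 cc1] [dab dbc dca] fr] := tri.
have neq (I J : {pred circle T}) x y :
    disjoint_preds I J -> x \in I -> y \in J -> x != y.
  by move=> d xI yJ; apply/eqP => e; have := d _ xI; rewrite e yJ.
have aI : a \in arc a a1 by rewrite arcE eqxx.
have a1I : a1 \in arc a a1 by rewrite arcE eqxx orbT.
have bI : b \in arc b b1 by rewrite arcE eqxx.
have b1I : b1 \in arc b b1 by rewrite arcE eqxx orbT.
have cI : c \in arc c c1 by rewrite arcE eqxx.
have c1I : c1 \in arc c c1 by rewrite arcE eqxx orbT.
have neqp x y z t : x != z -> (x, y) != (z, t) :> arrow T.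
  by move=> xz; apply: contraNneq xz => -[->].
have nC x y : [|| x \in arc a a1, x \in arc b b1 | x \in arc c c1] -> (x, y) \notin C.
  move=> xI; apply/negP => /endpoint1/fr[] /= /negPf h1 /negPf h2 /negPf h3.
  by rewrite h1 h2 h3 in xI.
rewrite !cobracket_sumE {1}bE {1}aE /triangle_before /triangle_after.
rewrite [LHS]sum_fset1U3; first rewrite [RHS]sum_fset1U3.
- congr (_ + (_ + (_ + _))); last first.
    apply/esym/sum_restrict_homotopic => e D eC De.
    have [h1 h2 h3] := fr _ (endpoint1 eC); have [h4 h5 h6] := fr _ (endpoint2 eC).
    by apply: (restrict_c tri aE bE); apply: same_on_both De.
  + exact/esym/loop_term_homotopic.
  + exact/esym/loop_term_homotopic.
  + exact/esym/loop_term_homotopic.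
all: try by apply: nC; rewrite ?aI ?a1I ?bI ?b1I ?cI ?c1I ?orbT.
all: apply: neqp.
all: try by [exact: neq dab _ _|exact: neq dbc _ _|exact: neq dca _ _].
all: try by rewrite eq_sym; exact: neq dca _ _.
Qed.

End Invariance.

(** * Homeomorphisms, and the linear map on homotopy classes *)

Section Homeo.
Variables (T : realType) (R : comPzRingType).
Implicit Types (alpha beta : vstring T) (e f : arrow T).

(** A homeomorphism which sends positive triples to positive triples also
    reflects them, so that it maps the loops of e onto the loops of its image. *)
Lemma cobracket_homeo alpha beta : homeo_strings alpha beta ->
  cobracket_sum R beta = cobracket_sum R alpha.
Proof.
move=> [h hh bE]; have [[g [hK gK _ _]] hccw] := hh.
have hinj := can_inj hK.
have ccw_h a b c : ccw (h a) (h b) (h c) = ccw a b c.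
  apply/idP/idP => [habc|]; last exact: hccw.
  have [n1 n2 n3] := ccw_neq habc.
  rewrite -[ccw a b c]negbK -ccw_total; try by rewrite -(inj_eq hinj).
  by apply/negP => /hccw; rewrite (ccw_asym habc).
pose k e := (h e.1, h e.2).
have kinj : injective k by move=> [? ?] [? ?] [/hinj -> /hinj ->].
have hom x y : homotopic (restrict alpha (open_arc x y))
                         (restrict beta (open_arc (h x) (h y))).
  apply: rst_step; constructor 1; exists h => //; apply/fsetP => e.
  rewrite in_restrict bE; apply/and3P/imfsetP => [[/imfsetP[e' /= eA ->]]|[e' /=]].
    rewrite !inE /= !ccw_h => e1 e2; exists e' => //=.
    by rewrite in_restrict eA !inE e1.
  rewrite in_restrict => /and3P[eA e1 e2] ->; split; rewrite ?inE /= ?ccw_h //.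
  by apply/imfsetP; exists e'.
rewrite !cobracket_sumE {1}bE big_imfset /=; last by move=> ? ? _ _ /kinj.
apply: eq_bigr => e _; apply/esym/loop_term_homotopic; exact: hom.
Qed.

Lemma cobracket_homotopic alpha beta : homotopic alpha beta ->
  cobracket_sum R alpha = cobracket_sum R beta.
Proof.
elim=> [x y []|//|x y _ -> //|x y z _ -> _ -> //].
- by move=> /cobracket_homeo.
- by move=> /cobracket_a.
- by move=> /cobracket_b.
- by move=> /cobracket_c.
Qed.

Lemma cobracket_trivial alpha :
  homotopically_trivial alpha -> cobracket_sum R alpha = 0.
Proof.
move=> [beta tb /cobracket_homotopic->].
by rewrite /cobracket_sum tb big_seq_fset0.
Qed.

Local Notation A0 := (A0 T R).

Definition representative (s : S0 T) : vstring T := sval (cid2 (set_valP s)).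

Lemma gen_representative s : string_gen R (representative s) = free_gen R s.
Proof.
rewrite /string_gen /representative; case: cid2 => alpha nt e /=.
case: pselect => // nt'; congr free_gen; exact: val_inj.
Qed.

Lemma representative_class alpha (nt : ~ homotopically_trivial alpha) :
  homotopic (representative (nontrivial_class nt)) alpha.
Proof.
rewrite /representative; case: cid2 => beta ntb /= e.
have : homotopy_class beta alpha by rewrite e; exact: homotopic_refl.
by [].
Qed.

Definition cobracket : {linear A0 -> tensor A0 A0} :=
  free_ext (fun s : S0 T => cobracket_sum R (representative s) : tensor A0 A0).

Lemma cobracketE alpha : cobracket (string_gen R alpha) = cobracket_sum R alpha.
Proof.
rewrite {1}/string_gen; case: pselect => [t|nt].
  by rewrite linear0 cobracket_trivial.
rewrite /cobracket /= free_ext_gen; apply: cobracket_homotopic.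
exact: representative_class.
Qed.

Lemma cobracket_uniq (nu : {linear A0 -> tensor A0 A0}) :
  (forall alpha, nu (string_gen R alpha) = cobracket_sum R alpha) -> nu =1 cobracket.
Proof.
by move=> h; apply: free_ext_uniq => s; rewrite -gen_representative h cobracketE.
Qed.

End Homeo.

(** * Cyclic sums and linearity *)

Lemma freemod_ind (R : pzRingType) (S : choiceType) (P : freemod R S -> Prop) :
  P 0 -> (forall k x y, P x -> P y -> P (k *: x + y)) ->
  (forall s, P (free_gen R s)) -> forall x, P x.
Proof.
move=> P0 PD Pg x; rewrite [x]freemod_sum /free_ext fsbig_finite; last exact: freemodP.
elim: (enum_fset _) => [|s r IH]; first by rewrite big_nil.
by rewrite big_cons; apply: PD.
Qed.

(** A form of free_ext_uniq for composites whose linearity is only a hypothesis. *)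
Lemma linear_ext (R : pzRingType) (S : choiceType) (W : lmodType R)
    (f g : freemod R S -> W) : linear f -> linear g ->
  (forall s, f (free_gen R s) = g (free_gen R s)) -> forall x, f x = g x.
Proof.
move=> lf lg fg; apply: freemod_ind => // [|k x y fx fy].
  by rewrite -[0](addr0 0) -[X in X + 0](scaler0 _ (-1)) lf lg !scaleN1r !addNr.
by rewrite lf lg fx fy.
Qed.

Section CyclicSum.
Variables (R : comPzRingType) (A : lmodType R).
Local Notation A2 := (tensor A A).
Local Notation A3 := (tensor A A2).

(** The left-hand side of the co-Jacobi identity, as a function of the
    iterated cobracket. *)
Definition cyclic_sum (t : A3) : A3 := t + tens_tau t + tens_tau (tens_tau t).

Lemma cyclic_sum_linear : linear cyclic_sum.
Proof.
have l : linear (@tens_tau R A) := tens_lift_linear (@tens_tau_bilinear R A).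
move=> k x y; rewrite /cyclic_sum !l !scalerDr.
set a := k *: x; set b := k *: _; set c := k *: _.
by rewrite (addrACA a) (addrACA (a + b)).
Qed.

Definition cyclic_tens (x y z : A) : A3 := cyclic_sum (x ⊗ (y ⊗ z)).

Lemma cyclic_tens_rot x y z : cyclic_tens x y z = cyclic_tens z x y.
Proof. by rewrite /cyclic_tens /cyclic_sum !tens_tauE -addrA addrC. Qed.

End CyclicSum.

(** * Antisymmetry and the co-Jacobi identity *)

Section Jacobi.
Variables (T : realType) (R : comPzRingType).
Implicit Types (alpha beta : vstring T) (e f : arrow T) (i j : arrow T * bool).
Local Notation gen := (string_gen R).
Local Notation A0 := (A0 T R).

(** An index is an arrow together with one of its two loops. Signed sums over
    indices replace the differences in the definition of the cobracket. *)
Definition side_of i : {pred circle T} :=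
  if i.2 then open_arc i.1.1 i.1.2 else open_arc i.1.2 i.1.1.

Definition flip i := (i.1, ~~ i.2).

Lemma flipK : involutive flip.
Proof. by case=> e s; rewrite /flip negbK. Qed.

Definition sgn (s : bool) : R := if s then 1 else -1.

Definition region alpha (D : {pred circle T}) : A0 := gen (restrict alpha D).

Lemma sgnN s : sgn (~~ s) = - sgn s.
Proof. by case: s; rewrite /sgn ?opprK. Qed.

Definition sides alpha : seq (arrow T * bool) :=
  [seq (e, s) | e <- arr alpha, s <- [:: true; false]].

Lemma sum_sides (V : nmodType) alpha (F : arrow T * bool -> V) :
  \sum_(i <- sides alpha) F i = \sum_(e <- arr alpha) (F (e, true) + F (e, false)).
Proof.
rewrite big_allpairs; apply: eq_bigr => e _.
by rewrite !big_cons big_nil /= addr0.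
Qed.

Lemma mem_sides alpha i : i \in sides alpha -> i.1 \in arr alpha.
Proof. by move=> /allpairsP[[e s] /= [eA _ ->]]. Qed.

Lemma sum_flip (V : nmodType) alpha (F : arrow T * bool -> V) :
  \sum_(i <- sides alpha) F (flip i) = \sum_(i <- sides alpha) F i.
Proof. by rewrite !sum_sides; apply: eq_bigr => e _; rewrite addrC. Qed.

Lemma region_ext alpha D D' : D =i D' -> region alpha D = region alpha D'.
Proof.
move=> DD; rewrite /region; congr string_gen; apply: vstring_eq.
by rewrite !arr_restrict; apply: eq_filter_inside => x _; exact: DD.
Qed.

Lemma region_restrict alpha D D' :
  region (restrict alpha D) D' = region alpha [predI D & D'].
Proof.
rewrite /region; congr string_gen; apply: vstring_eq; apply/fsetP => e.
by rewrite !in_restrict !inE; case: (e \in arr alpha) => //=; rewrite andbACA.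
Qed.

Lemma cobracket_restrict alpha D : cobracket_sum R (restrict alpha D) =
  \sum_(i <- sides alpha) (if inside D i.1 then sgn i.2 else 0) *:
    (region alpha [predI D & side_of i] ⊗ region alpha [predI D & side_of (flip i)]).
Proof.
rewrite cobracket_sumE sum_sides arr_restrict -big_fset_condE big_mkcond /=.
apply: eq_bigr => e _; case: ifP => _; last by rewrite !scale0r addr0.
by rewrite /loop_term /wedge -!region_restrict scale1r scaleN1r.
Qed.

Lemma restrictT alpha : restrict alpha predT = alpha.
Proof. by apply: vstring_eq; apply/fsetP => e; rewrite in_restrict !andbT. Qed.

Lemma cobracket_sum_sides alpha : cobracket_sum R alpha =
  \sum_(i <- sides alpha) sgn i.2 *:
    (region alpha (side_of i) ⊗ region alpha (side_of (flip i))).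
Proof.
rewrite -{1}[alpha]restrictT cobracket_restrict.
by apply: eq_bigr => i _; congr (_ *: (_ ⊗ _)); apply: region_ext.
Qed.

(** A chord u v with both ends on one side of the chord p q does not cross it:
    p and q lie on the same side of u v, and the other side of u v stays on
    the side of p q where u and v are. *)
Lemma noncrossing_arcs (p q u v : circle T) : u \in open_arc p q ->
  v \in open_arc p q -> u != v ->
  ((p \in open_arc v u) && (q \in open_arc v u) =
    ~~ ((p \in open_arc u v) && (q \in open_arc u v))) /\
  (p \in open_arc u v -> {subset open_arc v u <= open_arc p q}).
Proof.
rewrite !inE !(ccw_cut0 p) (cut_eq p) !(ccw_cut p) /cyc => hu hv uv; split.
  move: (cut p p) (cut p q) (cut p u) (cut p v) hu hv uv => p' q' u' v' *; lra.
move=> pv x; rewrite !inE (ccw_cut0 p) (ccw_cut p) /cyc.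
move: (cut p p) (cut p q) (cut p u) (cut p v) (cut p x) hu hv uv pv => p' q' u' v' x' *; lra.
Qed.

Lemma linear_sumZ (U V : lmodType R) (I : Type) (f : U -> V) (r : seq I)
    (k : I -> R) (F : I -> U) : linear f ->
  f (\sum_(i <- r) k i *: F i) = \sum_(i <- r) k i *: f (F i).
Proof.
move=> l; have f0 : f 0 = 0.
  by rewrite -[X in f X](scaler0 _ (-1)) -[X in f X]addr0 l scaleN1r addNr.
by elim: r => [|i r IH]; rewrite ?big_nil ?big_cons // l IH.
Qed.

Lemma antisym_gen alpha :
  tens_perm (cobracket T R (gen alpha)) = - cobracket T R (gen alpha).
Proof.
have lin : linear (@tens_perm R A0) := tens_lift_linear (@tens_perm_bilinear R A0).
rewrite cobracketE cobracket_sum_sides (linear_sumZ _ _ _ lin) -[LHS]sum_flip -sumrN.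
by apply: eq_bigr => i _; rewrite tens_permE flipK sgnN scaleNr.
Qed.

Section Sum.
Variable alpha : vstring T.

Definition opposite i j := inside (side_of (flip j)) i.1.

Definition outer i := region alpha (side_of i).

Definition middle i j := region alpha [predI side_of (flip i) & side_of (flip j)].

(** For two non-crossing arrows, with the loop i facing away from the arrow of j
    and conversely: the circle falls into the loop i, the loop j and the part
    between the arrows. *)
Definition config i j := if opposite j i && opposite i j
  then cyclic_tens (outer i) (outer j) (middle i j) else 0.

(** The term of the iterated cobracket where the circle is cut at the arrow of
    i, and the loop complementary to i is cut at the arrow of j. *)
Definition iterated i j := if opposite j i
  then cyclic_tens (outer i) (middle i (flip j)) (middle i j) else 0.

Lemma middleC i j : middle i j = middle j i.
Proof. by apply: region_ext => x; rewrite !inE andbC. Qed.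

(** If the arrow of j is in the loop complementary to i, then the arrow of i is in
    exactly one of the two loops of j. The other loop of j is contained in the
    complement of i, so that the two pieces cut out of that complement by the
    arrow of j are this other loop and the middle part; which of the two comes
    first decides between the two summands. *)
Lemma iterated_config i j : i.1 \in arr alpha -> j.1 \in arr alpha ->
  iterated i j = config i j + config (flip j) i.
Proof.
move=> iA jA; rewrite /iterated /config -[opposite (flip j) i]/(opposite j i).
case ji: (opposite j i) => /=; last by rewrite andbF addr0.
(* The loop i is open_arc q p, and the loop j is open_arc u v. *)
pose p := if i.2 then i.1.2 else i.1.1; pose q := if i.2 then i.1.1 else i.1.2.
pose u := if j.2 then j.1.1 else j.1.2; pose v := if j.2 then j.1.2 else j.1.1.
have iE : side_of (flip i) = open_arc p q.
  by rewrite /side_of /p /q /=; case: i.2.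
have jE : side_of j = open_arc u v by rewrite /side_of /u /v; case: j.2.
have jE' : side_of (flip j) = open_arc v u.
  by rewrite /side_of /u /v /=; case: j.2.
have insP D : inside D i.1 = (p \in D) && (q \in D).
  by rewrite /inside /p /q; case: i.2; rewrite // andbC.
have [uI vI] : u \in open_arc p q /\ v \in open_arc p q.
  by move: ji; rewrite /opposite /inside iE /u /v => /andP[]; case: j.2.
have uv : u != v.
  by have := arr_neq jA; rewrite /u /v; case: j.2; rewrite // eq_sym.
have [ex sub] := noncrossing_arcs uI vI uv.
have vu : v != u by rewrite eq_sym.
have [_ sub'] := noncrossing_arcs vI uI vu.
have lE : opposite i j = ~~ opposite i (flip j).
  by rewrite /opposite flipK !insP jE jE' ex.
have inner k : {subset side_of (flip k) <= side_of (flip i)} ->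
    middle i k = outer (flip k).
  move=> s; apply: region_ext => x; rewrite inE /= andbC.
  by case: (boolP (x \in side_of (flip k))) => // /s.
case: (boolP (opposite i (flip j))) => lij; rewrite lE ?lij ?(negPf lij) /= ?addr0 ?add0r.
- rewrite (inner j); last first.
    rewrite iE jE'; apply: sub; move: lij.
    by rewrite /opposite flipK insP jE => /andP[].
  by rewrite cyclic_tens_rot -(middleC i).
- rewrite (inner (flip j)) flipK //.
  have : opposite i j by rewrite lE lij.
  by rewrite /opposite insP jE' iE jE => /andP[/sub'].
Qed.

(** Flipping j changes the sign, and exchanging i and j after that turns the second
    summand of the decomposition into the opposite of the first. This needs no
    division by two, unlike pairing (i, j) with (j, i) in the original sum. *)
Lemma sum_config : \sum_(i <- sides alpha) \sum_(j <- sides alpha)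
  (sgn i.2 * sgn j.2) *: iterated i j = 0.
Proof.
rewrite (eq_big_seq (fun i => \sum_(j <- sides alpha) (sgn i.2 * sgn j.2) *: config i j
   + \sum_(j <- sides alpha) (sgn i.2 * sgn j.2) *: config (flip j) i)); last first.
  move=> i iA; rewrite -big_split; apply: eq_big_seq => j jA /=.
  by rewrite iterated_config ?mem_sides // scalerDr.
rewrite big_split /= addrC.
under eq_bigr => i _ do rewrite -sum_flip.
rewrite exchange_big -big_split /= big1 // => i _.
rewrite -big_split big1 //= => j _.
by rewrite flipK sgnN mulrN scaleNr mulrC addNr.
Qed.

Lemma jacobi_gen :
  cyclic_sum (tens_id_map (cobracket T R) (cobracket T R (gen alpha))) = 0.
Proof.
rewrite cobracketE cobracket_sum_sides -[RHS]sum_config.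
have lin : linear (tens_id_map (cobracket T R)) :=
  tens_lift_linear (tens_id_map_bilinear (cobracket T R)).
rewrite (linear_sumZ _ _ _ lin).
rewrite (linear_sumZ _ _ _ (@cyclic_sum_linear R A0)); apply: eq_bigr => i _.
rewrite tens_id_mapE cobracketE cobracket_restrict.
have [_ /(_ (region alpha (side_of i))) l] := tens_bilinear A0 (tensor A0 A0).
rewrite (linear_sumZ _ _ _ l) (linear_sumZ _ _ _ (@cyclic_sum_linear R A0)) scaler_sumr.
apply: eq_bigr => j _; rewrite scalerA /iterated /opposite.
case: ifP => _; last by rewrite mulr0 scale0r scaler0.
by rewrite /cyclic_tens /middle flipK.
Qed.

End Sum.

End Jacobi.

Theorem lemma8p2p1 (T : realType) (R : comPzRingType) :
  [/\ forall alpha beta : vstring T, homotopic alpha beta ->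
        cobracket_sum R alpha = cobracket_sum R beta,
      forall alpha : vstring T, homotopically_trivial alpha ->
        cobracket_sum R alpha = 0
    & exists nu : {linear A0 T R -> tensor (A0 T R) (A0 T R)},
        [/\ forall alpha : vstring T,
              nu (string_gen R alpha) = cobracket_sum R alpha,
            forall nu' : {linear A0 T R -> tensor (A0 T R) (A0 T R)},
              (forall alpha : vstring T,
                 nu' (string_gen R alpha) = cobracket_sum R alpha) ->
              nu' =1 nu
          & lie_cobracket nu]].
Proof.
split; [exact: cobracket_homotopic|exact: cobracket_trivial|].
exists (cobracket T R); split; [exact: cobracketE|exact: cobracket_uniq|].
have nu_lin : linear (cobracket T R) by exact: linearP.
have perm_lin : linear (@tens_perm R (A0 T R)) :=
  tens_lift_linear (@tens_perm_bilinear R (A0 T R)).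
have map_lin : linear (tens_id_map (cobracket T R)) :=
  tens_lift_linear (tens_id_map_bilinear (cobracket T R)).
split; apply: linear_ext => [k x y|k x y|s].
- by rewrite nu_lin perm_lin.
- by rewrite nu_lin opprD scalerN.
- by rewrite -gen_representative antisym_gen.
- exact: (etrans (congr1 _ (etrans (congr1 _ (nu_lin k x y)) (map_lin _ _ _)))
    (cyclic_sum_linear _ _ _)).
- by rewrite scaler0 addr0.
- by rewrite -gen_representative; exact: jacobi_gen.
Qed.
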